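(* Let $1<a\le b$. If $a=b$, then $Q(a,b;t)=0$ for every $t>b$. If $a<b$, then there exists $t>b$ such that $Q(a,b;t)=0$.
   Context: For real numbers with $1<a\le b<t$ put $(v_1,v_2,v_3,v_4,v_5,v_6)=(-t,-a,-1,1,b,t)$ and, for $1\le k\le5$, $$I_k=\int_{v_k}^{v_{k+1}}\sqrt{\frac{|z-b|}{|z+a|\,|z^2-1|\,|z^2-t^2|}}\,dz,\qquad J_k=\int_{v_k}^{v_{k+1}}\sqrt{\frac{|z+a|}{|z-b|\,|z^2-1|\,|z^2-t^2|}}\,dz,$$ and $$Q(a,b;t)=\frac{I_1+I_5}{I_2+I_4}-\frac{J_1+J_5}{J_2+J_4}.$$ The equation $Q(a,b;t)=0$ is called the period condition. *)

(* Defs.v *)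
From mathcomp Require Import all_boot all_order all_algebra.
From mathcomp Require Import all_classical all_reals all_analysis.

Set Implicit Arguments.
Unset Strict Implicit.
Unset Printing Implicit Defensive.
Import Order.TTheory GRing.Theory Num.Theory.
Import numFieldNormedType.Exports.
Local Open Scope classical_set_scope.
Local Open Scope ring_scope.

(* Vertices are numbered from 1: v_1 = -t, ..., v_6 = t. *)
Definition vertex (R : realType) (a b t : R) (k : nat) : R :=
  [:: - t; - a; - 1; 1; b; t]`_k.-1.

(* The integrals below are Lebesgue integrals.  For 1 < a <= b < t both
   integrands are nonnegative with at most inverse-square-root singularities
   at the vertices, so all the integrals are finite; the value 0 that division
   by 0 gives to an integrand at a vertex concerns a null set only. *)
Definition I_integrand (R : realType) (a b t z : R) : R :=
  Num.sqrt (`|z - b| / (`|z + a| * `|z ^+ 2 - 1| * `|z ^+ 2 - t ^+ 2|)).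

Definition J_integrand (R : realType) (a b t z : R) : R :=
  Num.sqrt (`|z + a| / (`|z - b| * `|z ^+ 2 - 1| * `|z ^+ 2 - t ^+ 2|)).

Definition I_ (R : realType) (a b t : R) (k : nat) : R :=
  \int[@lebesgue_measure R]_(z in `[vertex a b t k, vertex a b t k.+1])
    I_integrand a b t z.

Definition J_ (R : realType) (a b t : R) (k : nat) : R :=
  \int[@lebesgue_measure R]_(z in `[vertex a b t k, vertex a b t k.+1])
    J_integrand a b t z.

Definition Q (R : realType) (a b t : R) : R :=
  (I_ a b t 1 + I_ a b t 5) / (I_ a b t 2 + I_ a b t 4) -
  (J_ a b t 1 + J_ a b t 5) / (J_ a b t 2 + J_ a b t 4).

(* Main.v *)
(* If a = b, the reflection z |-> -z exchanges I_k and J_(6-k), so Q = 0.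

   If a < b, clear denominators and study the sign of
   N(t) = (I_1 + I_5) (J_2 + J_4) - (J_1 + J_5) (I_2 + I_4), which is continuous
   in t.  As t tends to b, J_4 blows up like -ln (t - b), while I_1 stays away
   from 0 and J_1, J_5, I_2, I_4 stay bounded; so N > 0.  As t tends to infinity,
   t (I_2 + I_4) and t (J_2 + J_4) tend to the integrals A_I and A_J of
   (b - z) / y and (z + a) / y over [-a, -1] and [1, b], where y^2 is
   |(z^2 - 1) (z + a) (z - b)|, t (J_1 + J_5) grows at least like ln t, and
   I_1 + I_5 exceeds J_1 + J_5 by O(1 / t) only; hence N < 0 because A_I > A_J.
   For this last inequality, the Moebius map that swaps -1 with 1 and -a with b
   preserves dz / y, and moves everything to [1, b], where the integrands can be
   compared pointwise. *)

Require Import Defs.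
From mathcomp Require Import all_boot all_order all_algebra.
From mathcomp Require Import ring lra.
From mathcomp Require Import all_classical all_reals all_analysis.
From mathcomp Require Import measurable_realfun.
Set Implicit Arguments.
Unset Strict Implicit.
Unset Printing Implicit Defensive.
Import Order.TTheory GRing.Theory Num.Theory.
Import numFieldNormedType.Exports.
Local Open Scope classical_set_scope.
Local Open Scope ring_scope.

(** The obstacle is that domain and integrand both move with t and that the integrands blow up at
    the ends. Every integral that occurs has the shape of a function regular on [p, q] times the
    arcsine kernel 1 / sqrt (|z - p| |z - q|), and the cubic substitution z = p + (q - p) x^2 (3 - 2
    x) turns it into the integral over [0, 1] of a continuous function. This one device yields
    finiteness, continuity in t (the domain is now fixed and the integrand is jointly continuous on
    a compact rectangle), and upper bounds that do not depend on the length of the interval.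

    No limit in t is ever taken. Both signs of N are exhibited at explicit points, t = b + exp (- T)
    and t = b exp T, chosen so that the logarithms in the lower bounds become linear in T.

    For large t the outer integrals are compared crosswise, I_5 with J_1 and I_1 with J_5: after z
    |-> - z the members of a pair live on nearly the same interval and both comparisons reduce to
    z^2 - b^2 <= z^2 - a^2. *)

(** * Change of variables for nonnegative integrands singular at the ends *)

Section substitution.
Variable R : realType.
Implicit Types (p q : R) (u F f G w : R -> R).
Notation mu := (@lebesgue_measure R).

(** Monotone convergence along closed intervals that exhaust the open one. Nothing is assumed at [p]
    and [q], a null set, so [u] may blow up there. *)
Lemma ge0_cvg_integral_itv u p q (x y : nat -> R) :
  (forall n, p < x n) -> (forall n, y n < q) ->
  nonincreasing_seq x -> nondecreasing_seq y ->
  x @ \oo --> p -> y @ \oo --> q ->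
  {in `]p, q[, continuous u} -> {in `]p, q[, forall z, 0 <= u z} ->
  (\int[mu]_(z in `[x n, y n]) (u z)%:E @[n --> \oo] -->
   \int[mu]_(z in `[p, q]) (u z)%:E)%E.
Proof.
move=> px yq xd yi xp yq' cu u0.
have mu_ : measurable_fun `]p, q[ u.
  apply: open_continuous_measurable_fun; first exact: interval_open.
  by move=> z; rewrite inE; exact: cu.
have sub n : `[x n, y n] `<=` `]p, q[.
  move=> z /=; rewrite !in_itv/= => /andP[xz zy].
  by rewrite (lt_le_trans (px n))//= (le_lt_trans zy).
rewrite (_ : (\int[mu]_(z in `[p, q]) _)%E =
    (\int[mu]_(z in \bigcup_n `[x n, y n]%classic) (u z)%:E)%E); last first.
  rewrite integral_itv_bndoo; last exact/measurable_EFinP.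
  congr (integral _ _ _); apply/seteqP; split => z /=; last first.
    by move=> [n _ /(sub n)].
  rewrite in_itv/= => /andP[pz zq].
  have [n _ /(_ n (leqnn n))[/= xz zy]] : \forall n \near \oo, x n < z /\ z < y n.
    by near=> n; split; near: n; [exact: cvgr_lt xp _ pz|exact: cvgr_gt yq' _ zq].
  by exists n => //=; rewrite in_itv/= !ltW.
apply: ge0_nondecreasing_set_cvg_integral => //.
- move=> m n mn; rewrite subsetEset => z /=; rewrite !in_itv/= => /andP[xz zy].
  by rewrite (le_trans _ xz) ?xd//= (le_trans zy) ?yi.
- by move=> n; apply/measurable_EFinP; exact: measurable_funS mu_.
- by move=> n z /sub; rewrite lee_fin; exact: u0.
Unshelve. all: end_near. Qed.

Lemma harmonic2_cvg (r : R) : (r / n.+2%:R) @[n --> \oo] --> (0 : R).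
Proof.
rewrite -(mulr0 r); apply: cvgMr.
have := @cvg_harmonic R.
by rewrite -(cvg_shiftS (fun n => (n.+1%:R^-1 : R))).
Qed.

Lemma exhaust_itv p q : p < q ->
  exists x y : nat -> R,
    [/\ forall n, p < x n /\ y n < q, forall n, x n <= y n,
        nonincreasing_seq x /\ nondecreasing_seq y,
        x @ \oo --> p & y @ \oo --> q].
Proof.
(* Denominators start at 2, so both sequences start at the midpoint and never cross. *)
move=> pq; exists (fun n => p + (q - p) / n.+2%:R), (fun n => q - (q - p) / n.+2%:R).
have d0 : 0 < q - p by rewrite subr_gt0.
have dec m n : (m <= n)%N -> (q - p) / n.+2%:R <= (q - p) / m.+2%:R.
  by move=> mn; rewrite ler_pM2l// lef_pV2 ?posrE// ler_nat.
split.
- by move=> n; rewrite ltrDl gtrBl divr_gt0.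
- move=> n /=; have : (q - p) / n.+2%:R <= (q - p) / 2 by exact: (dec 0 n).
  by move: ((q - p) / n.+2%:R) => A; lra.
- by split=> m n /dec /=; move: (_ / _) (_ / _) => A B; lra.
- rewrite -[X in _ --> X]addr0; apply: cvgD; first exact: cvg_cst.
  exact: harmonic2_cvg.
- rewrite -[X in _ --> X]subr0; apply: cvgB; first exact: cvg_cst.
  exact: harmonic2_cvg.
Qed.

Lemma continuous_within_itv u p q : {in `[p, q], continuous u} ->
  {within `[p, q], continuous u}.
Proof. by move=> cu; apply: continuous_in_subspaceT => z; rewrite inE; exact: cu. Qed.

(** On each [[x n, y n]] the data are continuous and the classical theorem applies; both sides then
    pass to the limit by monotone convergence. The pullback [w] is a separate function, tied to
    [G (F x) * f x] inside the interval only, so that it can be the continuous extension where the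
    product meets a division by 0. *)
Lemma ge0_substitution F f G w p q : p < q ->
  (forall x, x \in `[p, q] -> is_derive x 1 F (f x)) ->
  {in `[p, q], continuous f} -> {in `]p, q[, forall x, 0 < f x} ->
  {in `]F p, F q[, continuous G} -> {in `]F p, F q[, forall z, 0 <= G z} ->
  {in `]p, q[, continuous w} ->
  {in `]p, q[, forall x, w x = G (F x) * f x} ->
  (\int[mu]_(z in `[F p, F q]) (G z)%:E = \int[mu]_(x in `[p, q]) (w x)%:E)%E.
Proof.
move=> pq dF cf f0 cG G0 cw wE.
have cF : {in `[p, q], continuous F}.
  move=> x xpq; apply/differentiable_continuous/derivable1_diffP.
  by have := dF x xpq => -[].
have oc x : x \in `]p, q[ -> x \in `[p, q] by exact: subset_itv_oo_cc.
have F'E x : x \in `[p, q] -> (derive1 F) x = f x.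
  by move=> xpq; rewrite derive1E; have := dF x xpq => -[].
have homoF : {in `[p, q] &, {homo F : x y / x < y}}.
  apply: gtr0_derive1_lt_cc.
  - by move=> x /oc /dF[].
  - by move=> x xpq; rewrite F'E ?oc//; exact: f0.
  - exact: continuous_within_itv.
have whomoF : {in `[p, q] &, {homo F : x y / x <= y}}.
  move=> x y xpq ypq; rewrite le_eqVlt => /predU1P[->//|xy].
  by rewrite ltW// homoF.
have pin : p \in `[p, q] by rewrite in_itv/= lexx ltW.
have qin : q \in `[p, q] by rewrite in_itv/= lexx ltW.
have [x [y [pxyq xy [xd yi] xp yq]]] := exhaust_itv pq.
have xin n : x n \in `]p, q[.
  by have [? ?] := pxyq n; rewrite in_itv/=; apply/andP; split=> //; exact: le_lt_trans (xy n) _.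
have yin n : y n \in `]p, q[.
  by have [? ?] := pxyq n; rewrite in_itv/=; apply/andP; split=> //; exact: lt_le_trans (xy n).
have : (\int[mu]_(z in `[F (x n), F (y n)]) (G z)%:E @[n --> \oo] -->
   \int[mu]_(z in `[F p, F q]) (G z)%:E)%E.
  apply: ge0_cvg_integral_itv => //.
  - by move=> n; apply: homoF => //; [exact: oc|case: (pxyq n)].
  - by move=> n; apply: homoF => //; [exact: oc|case: (pxyq n)].
  - by move=> m n mn; apply: whomoF; rewrite ?oc// xd.
  - by move=> m n mn; apply: whomoF; rewrite ?oc// yi.
  - by apply: continuous_cvg => //; exact: cF.
  - by apply: continuous_cvg => //; exact: cF.
have : (\int[mu]_(z in `[x n, y n]) (w z)%:E @[n --> \oo] -->
   \int[mu]_(z in `[p, q]) (w z)%:E)%E.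
  apply: ge0_cvg_integral_itv => //.
  - by move=> n; case: (pxyq n).
  - by move=> n; case: (pxyq n).
  - move=> z zpq; rewrite wE// mulr_ge0 ?(ltW (f0 _ _))// G0//.
    move: zpq; rewrite !in_itv/= => /andP[pz zq].
    by rewrite !homoF// in_itv/= ?ltW.
rewrite (_ : (fun n => _) = (fun n => \int[mu]_(z in `[F (x n), F (y n)]) (G z)%:E)%E).
  by move=> h1 h2; exact: (cvg_unique _ h2 h1).
apply/funext => n.
have sub z : z \in `[x n, y n] -> z \in `]p, q[.
  have := xin n; have := yin n; rewrite !in_itv/= => /andP[_ yq'] /andP[px _] /andP[xz zy].
  by rewrite (lt_le_trans px)//= (le_lt_trans zy).
have subo z : z \in `]x n, y n[ -> z \in `]p, q[ by move=> /subset_itv_oo_cc; exact: sub.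
have cF'z z : z \in `]p, q[ -> {for z, continuous (derive1 F)}.
  move=> zpq; have := cf z (oc _ zpq); rewrite /prop_for /continuous_at F'E ?oc//.
  apply: cvg_trans; apply: near_eq_cvg; near=> t.
  by rewrite F'E// oc//; near: t; exact: near_in_itvoo.
rewrite integration_by_substitution_increasing//.
- apply: eq_integral => z; rewrite inE/= => /sub zpq.
  by rewrite !fctE F'E ?oc// wE.
- by move=> s t sI tI; apply: homoF; rewrite ?oc// ?sub.
- by move=> z /subo; exact: cF'z.
- by apply/cvg_ex; exists ((derive1 F) (x n)); apply: cvg_at_right_filter; exact: cF'z.
- by apply/cvg_ex; exists ((derive1 F) (y n)); apply: cvg_at_left_filter; exact: cF'z.
- split.
  + by move=> z /subo/oc/dF[].
  + by apply: cvg_at_right_filter; apply: cF; exact: oc.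
  + by apply: cvg_at_left_filter; apply: cF; exact: oc.
- apply: continuous_within_itv => z; rewrite in_itv/= => /andP[xz zy].
  have [px yq'] := pxyq n.
  apply: cG; rewrite in_itv/=; apply/andP; split.
    by apply: lt_le_trans xz; apply: homoF => //; exact: oc.
  by apply: (le_lt_trans zy); apply: homoF => //; exact: oc.
Unshelve. all: end_near. Qed.

Lemma ge0_integral_oppr G p q : p < q ->
  {in `]p, q[, continuous G} -> {in `]p, q[, forall z, 0 <= G z} ->
  (\int[mu]_(z in `[(- q)%R, (- p)%R]) (G (- z))%:E = \int[mu]_(x in `[p, q]) (G x)%:E)%E.
Proof.
move=> pq cG G0.
have [x [y [pxyq xy [xd yi] xp yq]]] := exhaust_itv pq.
have mem z : z \in `]- q, - p[ -> - z \in `]p, q[.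
  by rewrite !in_itv/= => /andP[? ?]; apply/andP; split; [rewrite ltrNr|rewrite ltrNl].
have : (\int[mu]_(z in `[(- y n)%R, (- x n)%R]) (G (- z))%:E @[n --> \oo] -->
   \int[mu]_(z in `[(- q)%R, (- p)%R]) (G (- z))%:E)%E.
  apply: ge0_cvg_integral_itv => //.
  - by move=> n; rewrite ltrN2; case: (pxyq n).
  - by move=> n; rewrite ltrN2; case: (pxyq n).
  - by move=> m n mn; rewrite lerN2 yi.
  - by move=> m n mn; rewrite lerN2 xd.
  - exact: cvgN.
  - exact: cvgN.
  - move=> z /mem zpq; apply: (continuous_comp (@oppr_continuous _ _ z)).
    exact: cG.
  - by move=> z /mem; exact: G0.
have : (\int[mu]_(z in `[x n, y n]) (G z)%:E @[n --> \oo] -->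
   \int[mu]_(z in `[p, q]) (G z)%:E)%E.
  apply: ge0_cvg_integral_itv => //.
  - by move=> n; case: (pxyq n).
  - by move=> n; case: (pxyq n).
rewrite (_ : (fun n => _) = (fun n => \int[mu]_(z in `[(- y n)%R, (- x n)%R]) (G (- z))%:E)%E).
  by move=> h1 h2; exact: (cvg_unique _ h2 h1).
apply/funext => n.
have := @integration_by_substitution_oppr R G (- y n) (- x n).
rewrite !opprK lerN2 => -> //.
apply: continuous_within_itv => z; rewrite in_itv/= => /andP[xz zy].
have [? ?] := pxyq n.
by apply: cG; rewrite in_itv/= (lt_le_trans _ xz) ?(le_lt_trans zy).
Qed.

End substitution.

(** * Pointwise continuity, proved by following the syntax of the function *)

Section continuity.
Variables (R : realType) (T : topologicalType) (x : T).
Implicit Types f h : T -> R.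

Lemma continuous_at_cst (c : R) : {for x, continuous (fun _ : T => c)}.
Proof. exact: cvg_cst. Qed.

Lemma continuous_at_add f h : {for x, continuous f} -> {for x, continuous h} ->
  {for x, continuous (fun y => f y + h y)}.
Proof. exact: continuousD. Qed.

Lemma continuous_at_sub f h : {for x, continuous f} -> {for x, continuous h} ->
  {for x, continuous (fun y => f y - h y)}.
Proof. exact: continuousB. Qed.

Lemma continuous_at_mul f h : {for x, continuous f} -> {for x, continuous h} ->
  {for x, continuous (fun y => f y * h y)}.
Proof. exact: continuousM. Qed.

Lemma continuous_at_div f h : {for x, continuous f} -> {for x, continuous h} ->
  h x != 0 -> {for x, continuous (fun y => f y / h y)}.
Proof.
by move=> cf ch hx; apply: (continuousM cf); exact: continuousV hx ch.
Qed.

Lemma continuous_at_sqrt f : {for x, continuous f} ->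
  {for x, continuous (fun y => Num.sqrt (f y))}.
Proof. by move=> cf; apply: (continuous_comp cf); exact: sqrt_continuous. Qed.

Lemma continuous_at_norm f : {for x, continuous f} ->
  {for x, continuous (fun y => `|f y|)}.
Proof. by move=> cf; apply: (continuous_comp cf); exact: norm_continuous. Qed.

Lemma continuous_at_exp n f : {for x, continuous f} ->
  {for x, continuous (fun y => f y ^+ n)}.
Proof.
move=> cf; apply: (@continuous_comp _ _ _ f (fun z : R => z ^+ n)) => //.
exact: exprn_continuous.
Qed.

End continuity.

Lemma continuous_at_id (R : realType) (x : R) : {for x, continuous (fun y : R => y)}.
Proof. exact: cvg_id. Qed.

(** The order of the cases matters: a difference is also a sum and a quotient is also a product. The
    cases [GRing.mul _] and [Algebra.add _] catch eta-reduced functions, such as multiplication by a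
    constant. *)
Ltac continuity_step x f := lazymatch f with
  | (fun _ => ?c) => exact: (@continuous_at_cst _ _ x)
  | (fun y => y) => exact: (@continuous_at_id _ x)
  | (fun y => @?u y - @?v y) => apply: (@continuous_at_sub _ _ x)
  | (fun y => @?u y + @?v y) => apply: (@continuous_at_add _ _ x)
  | (fun y => @?u y / @?v y) => apply: (@continuous_at_div _ _ x)
  | (fun y => @?u y * @?v y) => apply: (@continuous_at_mul _ _ x)
  | GRing.mul _ => apply: (@continuous_at_mul _ _ x)
  | Algebra.add _ => apply: (@continuous_at_add _ _ x)
  | (fun y => @?u y ^+ _) => apply: (@continuous_at_exp _ _ x)
  | (fun y => Num.sqrt (@?u y)) => apply: (@continuous_at_sqrt _ _ x)
  | (fun y => `|@?u y|) => apply: (@continuous_at_norm _ _ x)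
  end.

Ltac continuity x := repeat lazymatch goal with
  | |- continuous_at _ ?f => continuity_step x f
  | |- prop_for _ (inPhantom (forall y, continuous_at y ?f)) => continuity_step x f
  end.

(** * Desingularization of the arcsine kernel by a cubic *)

Section arcsine_kernel.
Variable R : realType.
Implicit Types (p q c M : R) (g u : R -> R).
Notation mu := (@lebesgue_measure R).

Definition smoothstep (x : R) := x ^+ 2 * (3 - 2 * x).

(** With s = [smoothstep x], 1 - s = (1 - x)^2 (1 + 2 x), so sqrt (s (1 - s)) = x (1 - x) times this
    function. As ds = 6 x (1 - x) dx, the kernel ds / sqrt (s (1 - s)) becomes 6 dx divided by it;
    this is the origin of every factor 6 in the bounds. *)
Definition smoothstep_jac (x : R) := Num.sqrt ((3 - 2 * x) * (1 + 2 * x)).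

Lemma is_derive_smoothstep p q (x : R) :
  is_derive x 1 (fun x => p + (q - p) * smoothstep x)
    ((q - p) * (6 * (x * (1 - x)))).
Proof.
rewrite /smoothstep; apply: is_derive_eq.
rewrite /GRing.scale /=; ring.
Qed.

Lemma smoothstep_itv p q (x : R) : p < q -> x \in `[0, 1] ->
  p + (q - p) * smoothstep x \in `[p, q].
Proof.
move=> pq; rewrite !in_itv/= /smoothstep => /andP[x0 x1].
have d0 : 0 <= q - p by rewrite subr_ge0 ltW.
apply/andP; split.
  by rewrite lerDl mulr_ge0// mulr_ge0 ?sqr_ge0//; lra.
rewrite -lerBrDl -{2}[q - p]mulr1 ler_wpM2l//.
rewrite -subr_ge0 (_ : _ - _ = (1 - x) ^+ 2 * (1 + 2 * x)); last by ring.
by rewrite mulr_ge0 ?sqr_ge0//; lra.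
Qed.

Lemma smoothstep_jac_ge1 (x : R) : x \in `[0, 1] -> 1 <= smoothstep_jac x.
Proof.
rewrite in_itv/= => /andP[x0 x1]; rewrite /smoothstep_jac -[leLHS]sqrtr1.
by rewrite ler_wsqrtr//; nra.
Qed.

Lemma smoothstep_jac_continuous (x : R) : {for x, continuous smoothstep_jac}.
Proof. by rewrite /smoothstep_jac; continuity (x : R). Qed.

Lemma smoothstep_continuous (x : R) : {for x, continuous smoothstep}.
Proof. by rewrite /smoothstep; continuity (x : R). Qed.

(* With s(x) = x^2 (3 - 2 x), both s and 1 - s have a double zero at an end of
   [0, 1], which cancels the singularities. *)
Lemma arcsine_kernelE g p q : p < q -> {in `[p, q], continuous g} ->
  {in `[p, q], forall z, 0 <= g z} ->
  (\int[mu]_(z in `[p, q]) (g z / Num.sqrt (`|z - p| * `|z - q|))%:E =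
   \int[mu]_(x in `[0%R, 1%R])
     (6 * (g (p + (q - p) * smoothstep x) / smoothstep_jac x))%:E)%E.
Proof.
move=> pq cg g0.
pose F x := p + (q - p) * smoothstep x.
have F0 : F 0 = p by rewrite /F /smoothstep; ring.
have F1 : F 1 = q by rewrite /F /smoothstep; ring.
rewrite -[in LHS]F0 -[in LHS]F1.
apply: (@ge0_substitution R F (fun x => (q - p) * (6 * (x * (1 - x))))
  (fun z => g z / Num.sqrt (`|z - F 0| * `|z - F 1|))) => //.
- by move=> x _; exact: is_derive_smoothstep.
- by move=> x _; continuity (x : R).
- by move=> x; rewrite in_itv/= => /andP[x0 x1]; rewrite !mulr_gt0// subr_gt0.
- rewrite F0 F1 => z zpq; continuity (z : R).
  + by apply: cg; exact: subset_itv_oo_cc.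
  + move: zpq; rewrite in_itv/= => /andP[pz zq].
    by rewrite sqrtr_eq0 -ltNge mulr_gt0// normr_gt0 subr_eq0; [rewrite gt_eqF|rewrite lt_eqF].
- rewrite F0 F1 => z /subset_itv_oo_cc zpq.
  by rewrite divr_ge0 ?sqrtr_ge0// g0.
- move=> x /subset_itv_oo_cc x01; continuity (x : R).
  + apply: (@continuous_comp R R R (fun x => p + (q - p) * smoothstep x) g).
      by continuity (x : R); exact: smoothstep_continuous.
    by apply: cg; exact: smoothstep_itv.
  + exact: smoothstep_jac_continuous.
  + by rewrite gt_eqF// (lt_le_trans _ (smoothstep_jac_ge1 x01)).
- move=> x; rewrite in_itv/= => /andP[x0 x1].
  have d0 : 0 < q - p by rewrite subr_gt0.
  have j0 : 0 < smoothstep_jac x.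
    by rewrite (lt_le_trans ltr01)// smoothstep_jac_ge1// in_itv/= !ltW.
  rewrite F0 F1 -normrM.
  rewrite (_ : (F x - p) * (F x - q) =
     - ((q - p) * (x * (1 - x))) ^+ 2 * ((3 - 2 * x) * (1 + 2 * x))); last first.
    by rewrite /F /smoothstep; ring.
  rewrite mulNr normrN ger0_norm; last first.
    by rewrite mulr_ge0 ?sqr_ge0//; nra.
  rewrite sqrtrM ?sqr_ge0// sqrtr_sqr ger0_norm; last by rewrite !mulr_ge0 ?subr_ge0 ?ltW.
  rewrite -/(smoothstep_jac x) -/(F x).
  by field; rewrite ?gt_eqF//= ?subr_gt0.
Qed.

End arcsine_kernel.

(** * Comparison of integrals, and integrals depending on a parameter *)

Section integrals.
Variable R : realType.
Implicit Types (p q c M : R) (f g u : R -> R).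
Notation mu := (@lebesgue_measure R).

Lemma measurable_fun_itvcc u p q : {in `]p, q[, continuous u} ->
  measurable_fun `[p, q] u.
Proof.
move=> cu; apply/measurable_fun_itv_bndo_bndcP/measurable_fun_itv_obnd_cbndP.
apply: open_continuous_measurable_fun; first exact: interval_open.
by move=> z; rewrite inE; exact: cu.
Qed.

Lemma Rintegral_itvoo u p q : mu.-integrable `[p, q] (EFin \o u) ->
  \int[mu]_(z in `]p, q[) u z = \int[mu]_(z in `[p, q]) u z.
Proof.
move=> iu; have io : mu.-integrable `]p, q] (EFin \o u).
  by apply: integrableS iu => //; exact: subset_itv_oc_cc.
rewrite Rintegral_itv_bndo_bndc ?Rintegral_itv_obnd_cbnd//.
by apply: integrableS iu => //; exact: subset_itv_oo_cc.
Qed.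

(** The comparison is required inside the interval only: at an end, a division by 0 may give [g] the
    value 0 and break the inequality. *)
Lemma le_Rintegral_itv f g p q :
  mu.-integrable `[p, q] (EFin \o f) -> mu.-integrable `[p, q] (EFin \o g) ->
  {in `]p, q[, forall z, f z <= g z} ->
  \int[mu]_(z in `[p, q]) f z <= \int[mu]_(z in `[p, q]) g z.
Proof.
move=> fi gi fg; rewrite -!Rintegral_itvoo//.
by apply: le_Rintegral => //; [apply: integrableS fi => //|apply: integrableS gi => //];
  exact: subset_itv_oo_cc.
Qed.

Lemma integrable_itv_cst p q c : mu.-integrable `[p, q] (EFin \o cst c).
Proof.
apply: continuous_compact_integrable; first exact: segment_compact.
by apply: continuous_subspaceT => z; exact: cvg_cst.
Qed.

Lemma Rintegral_itv_cst p q c : p <= q -> \int[mu]_(z in `[p, q]) c = c * (q - p).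
Proof.
move=> pq; rewrite Rintegral_cst//= lebesgue_measure_itv/= lte_fin.
case: ltP => //= qp; have -> : p = q by apply/eqP; rewrite eq_le pq.
by rewrite subrr.
Qed.

Lemma ge0_subset_Rintegral u p q p' q' : p <= p' -> q' <= q ->
  mu.-integrable `[p, q] (EFin \o u) -> {in `[p, q], forall z, 0 <= u z} ->
  \int[mu]_(z in `[p', q']) u z <= \int[mu]_(z in `[p, q]) u z.
Proof.
move=> pp' qq' iu u0.
have sub : `[p', q'] `<=` `[p, q] by apply: subset_itv; rewrite bnd_simp.
have iu' : mu.-integrable `[p', q'] (EFin \o u) by exact: integrableS iu.
apply: fine_le; [exact: integrable_fin_num..|].
apply: ge0_subset_integral => //.
exact: measurable_int iu.
Qed.

Lemma Rintegral_ge_cst u p q p' q' c : p <= p' -> p' <= q' -> q' <= q ->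
  mu.-integrable `[p, q] (EFin \o u) -> {in `[p, q], forall z, 0 <= u z} ->
  {in `]p', q'[, forall z, c <= u z} ->
  c * (q' - p') <= \int[mu]_(z in `[p, q]) u z.
Proof.
move=> pp' pq' qq' iu u0 cu; rewrite -Rintegral_itv_cst//.
apply: le_trans (ge0_subset_Rintegral pp' qq' iu u0).
have sub : `[p', q'] `<=` `[p, q] by apply: subset_itv; rewrite bnd_simp.
apply: le_Rintegral_itv => //; first exact: integrable_itv_cst.
exact: integrableS iu.
Qed.

Lemma Rintegral_oppr u p q : p < q ->
  {in `]p, q[, continuous u} -> {in `]p, q[, forall z, 0 <= u z} ->
  \int[mu]_(z in `[- q, - p]) u (- z) = \int[mu]_(z in `[p, q]) u z.
Proof. by move=> pq cu u0; rewrite /Rintegral ge0_integral_oppr. Qed.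

Section kernel.
Variables (g : R -> R) (p q : R).
Hypotheses (pq : p < q) (cg : {in `[p, q], continuous g})
  (g0 : {in `[p, q], forall z, 0 <= g z}).

Lemma arcsine_kernel_pullback_continuous :
  {in `[0, 1], continuous
     (fun x : R => 6 * (g (p + (q - p) * smoothstep x) / smoothstep_jac x))}.
Proof.
move=> x x01; continuity (x : R).
- apply: (@continuous_comp R R R (fun x => p + (q - p) * smoothstep x) g).
    by continuity (x : R); exact: smoothstep_continuous.
  by apply: cg; exact: smoothstep_itv.
- exact: smoothstep_jac_continuous.
- by rewrite gt_eqF// (lt_le_trans _ (smoothstep_jac_ge1 x01)).
Qed.

Lemma arcsine_kernel_integrable :
  mu.-integrable `[p, q] (EFin \o (fun z => g z / Num.sqrt (`|z - p| * `|z - q|))).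
Proof.
apply/integrableP; split.
  apply/measurable_EFinP; apply: measurable_fun_itvcc => z zpq; continuity (z : R).
  + by apply: cg; exact: subset_itv_oo_cc.
  + move: zpq; rewrite in_itv/= => /andP[pz zq].
    by rewrite sqrtr_eq0 -ltNge mulr_gt0// normr_gt0 subr_eq0; [rewrite gt_eqF|rewrite lt_eqF].
under eq_integral.
  move=> z; rewrite inE => zpq /=.
  rewrite ger0_norm; last by rewrite divr_ge0 ?g0 ?sqrtr_ge0.
  over.
rewrite arcsine_kernelE//.
have := continuous_compact_integrable (@segment_compact _ 0 1)
  (continuous_within_itv arcsine_kernel_pullback_continuous).
by move=> /integrable_lty; apply.
Qed.

Lemma Rintegral_arcsine_kernel :
  \int[mu]_(z in `[p, q]) (g z / Num.sqrt (`|z - p| * `|z - q|)) =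
  \int[mu]_(x in `[0, 1]) (6 * (g (p + (q - p) * smoothstep x) / smoothstep_jac x)).
Proof. by rewrite /Rintegral arcsine_kernelE. Qed.

End kernel.

(** After the substitution the majorant is [6 * M] divided by a function that is at least 1, on an
    interval of length 1. The exact integral of the kernel is pi, but any constant independent of
    [p] and [q] is enough. *)
Lemma Rintegral_le_arcsine f p q M : p < q -> 0 <= M ->
  mu.-integrable `[p, q] (EFin \o f) ->
  {in `]p, q[, forall z, f z <= M / Num.sqrt (`|z - p| * `|z - q|)} ->
  \int[mu]_(z in `[p, q]) f z <= 6 * M.
Proof.
move=> pq M0 fi fM.
have cM : {in `[p, q], continuous (fun=> M : R)} by move=> z _; exact: cvg_cst.
have M0' : {in `[p, q], forall z : R, 0 <= M} by [].
apply: (le_trans (le_Rintegral_itv fi (arcsine_kernel_integrable pq cM M0') fM)).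
rewrite Rintegral_arcsine_kernel//.
have -> : 6 * M = \int[mu]_(z in `[(0 : R), 1]) (6 * M).
  by rewrite Rintegral_itv_cst// subr0 mulr1.
apply: le_Rintegral_itv.
- apply: continuous_compact_integrable; first exact: segment_compact.
  by apply: continuous_within_itv; exact: (arcsine_kernel_pullback_continuous pq cM).
- exact: integrable_itv_cst.
- move=> x /subset_itv_oo_cc /smoothstep_jac_ge1 j1.
  rewrite ler_pM2l// ler_pdivrMr ?(lt_le_trans _ j1)//.
  by rewrite ler_peMr.
Qed.

(** Joint continuity on the compact rectangle bounds [h] by a constant, which serves as the
    dominating function. *)
Lemma continuous_param_Rintegral (h : R * R -> R) (t1 t2 : R) :
  (forall tx : R * R, tx.1 \in `[t1, t2] -> tx.2 \in `[0, 1] ->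
     {for tx, continuous h}) ->
  {in `]t1, t2[, continuous (fun t => \int[mu]_(x in `[0, 1]) h (t, x))}.
Proof.
move=> ch.
have [M hM] : exists M, forall t x, t \in `[t1, t2] -> x \in `[0, 1] -> `|h (t, x)| <= M.
  have cpt : compact (`[t1, t2] `*` `[0, 1] : set (R * R)).
    by apply: compact_setX; exact: segment_compact.
  have cw : {within (`[t1, t2] `*` `[0, 1] : set (R * R)), continuous h}.
    by apply: continuous_in_subspaceT => tx; rewrite inE => -[]; exact: ch.
  have /compact_bounded[M [_ hM]] := continuous_compact cw cpt.
  exists (M + 1) => t x tI xI; apply: (hM (M + 1)); first by rewrite ltrDl.
  by exists (t, x).
have cx t : t \in `[t1, t2] -> {in `[0, 1], continuous (fun x => h (t, x))}.
  move=> tI x xI; apply: (@continuous_comp R (R * R)%type R (fun x => (t, x)) h).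
    by apply: (@cvg_pair _ _ _ (nbhs x) (nbhs t) (nbhs x)); [exact: cvg_cst|exact: cvg_id].
  exact: ch.
move=> t tI.
apply: (@continuity_under_integral R _ _ mu (fun t x => h (t, x)) `[0, 1] _ t1 t2 _ _ (cst M)) => //.
- move=> s /subset_itv_oo_cc sI.
  apply: continuous_compact_integrable; first exact: segment_compact.
  by apply: continuous_within_itv; exact: cx.
- apply: aeW => x xI s; rewrite inE => /subset_itv_oo_cc sI.
  apply: (@continuous_comp R (R * R)%type R (fun s => (s, x)) h).
    by apply: (@cvg_pair _ _ _ (nbhs s) (nbhs s) (nbhs x)); [exact: cvg_id|exact: cvg_cst].
  exact: ch.
- exact: integrable_itv_cst.
- by move=> s /subset_itv_oo_cc sI; apply: aeW => x xI; exact: hM.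
- by rewrite inE.
Qed.

End integrals.

Ltac itv_notin := rewrite ?in_itv/=; apply/negP => /andP[? ?]; lra.

(** * A common form for all the integrands *)

Section kern.
Variable R : realType.
Implicit Types (e p q r a b t z : R).
Notation mu := (@lebesgue_measure R).

(** The denominator contains all six vertices, including the root [e] of the numerator: sqrt (x / y)
    is written as x / sqrt (x y). So the two families differ only in [e]. As a rule [p] and [q] are
    the ends of the interval of integration. *)
Definition kern e p q r1 r2 r3 r4 z :=
  `|z - e| / Num.sqrt (`|z - p| * `|z - q| *
    (`|z - r1| * `|z - r2| * (`|z - r3| * `|z - r4|))).

(** What remains of [kern] without the arcsine kernel of [p, q]. With the roots 1, b, -1, -a it is
    also |z - e| / y, the limit of t times the integrand as t tends to infinity. *)
Definition kern_reg e r1 r2 r3 r4 z :=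
  `|z - e| / Num.sqrt (`|z - r1| * `|z - r2| * (`|z - r3| * `|z - r4|)).

Lemma kernE e p q r1 r2 r3 r4 z : kern e p q r1 r2 r3 r4 z =
  kern_reg e r1 r2 r3 r4 z / Num.sqrt (`|z - p| * `|z - q|).
Proof.
by rewrite /kern /kern_reg sqrtrM ?mulr_ge0// invfM -!mulrA [_^-1 * _^-1]mulrC.
Qed.

Lemma kern_reg_ge0 e r1 r2 r3 r4 z : 0 <= kern_reg e r1 r2 r3 r4 z.
Proof. by rewrite divr_ge0 ?sqrtr_ge0. Qed.

Lemma kern_ge0 e p q r1 r2 r3 r4 z : 0 <= kern e p q r1 r2 r3 r4 z.
Proof. by rewrite divr_ge0 ?sqrtr_ge0. Qed.

Lemma kern_reg_continuous e r1 r2 r3 r4 z :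
  z != r1 -> z != r2 -> z != r3 -> z != r4 ->
  {for z, continuous (kern_reg e r1 r2 r3 r4)}.
Proof.
move=> z1 z2 z3 z4; rewrite /kern_reg; continuity (z : R).
by rewrite sqrtr_eq0 -ltNge !mulr_gt0// normr_gt0 subr_eq0.
Qed.

Section fixed_interval.
Variables (e p q r1 r2 r3 r4 : R).
Hypotheses (pq : p < q) (h1 : r1 \notin `[p, q]) (h2 : r2 \notin `[p, q])
  (h3 : r3 \notin `[p, q]) (h4 : r4 \notin `[p, q]).

Let neq z r : z \in `[p, q] -> r \notin `[p, q] -> z != r.
Proof. by move=> zpq; apply: contraNneq => <-. Qed.

Lemma kern_reg_continuous_itv : {in `[p, q], continuous (kern_reg e r1 r2 r3 r4)}.
Proof. by move=> z zpq; apply: kern_reg_continuous; exact: neq. Qed.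

Lemma kern_continuous_itv : {in `]p, q[, continuous (kern e p q r1 r2 r3 r4)}.
Proof.
move=> z zpq; rewrite (_ : kern _ _ _ _ _ _ _ =
  fun z => kern_reg e r1 r2 r3 r4 z / Num.sqrt (`|z - p| * `|z - q|)).
  apply: (@continuous_at_div _ _ z).
  - by apply: kern_reg_continuous_itv; exact: subset_itv_oo_cc.
  - by continuity (z : R).
  - move: zpq; rewrite in_itv/= => /andP[pz zq].
    by rewrite sqrtr_eq0 -ltNge mulr_gt0// normr_gt0 subr_eq0; [rewrite gt_eqF|rewrite lt_eqF].
by apply/funext => x; rewrite kernE.
Qed.

Lemma kern_integrable : mu.-integrable `[p, q] (EFin \o kern e p q r1 r2 r3 r4).
Proof.
rewrite (_ : kern _ _ _ _ _ _ _ =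
  fun z => kern_reg e r1 r2 r3 r4 z / Num.sqrt (`|z - p| * `|z - q|)); last first.
  by apply/funext => x; rewrite kernE.
apply: arcsine_kernel_integrable => //; first exact: kern_reg_continuous_itv.
by move=> z _; exact: kern_reg_ge0.
Qed.

Lemma Rintegral_kern : \int[mu]_(z in `[p, q]) kern e p q r1 r2 r3 r4 z =
  \int[mu]_(x in `[0, 1])
    (6 * (kern_reg e r1 r2 r3 r4 (p + (q - p) * smoothstep x) / smoothstep_jac x)).
Proof.
under eq_Rintegral do rewrite kernE.
rewrite Rintegral_arcsine_kernel//; first exact: kern_reg_continuous_itv.
by move=> z _; exact: kern_reg_ge0.
Qed.

End fixed_interval.

(** Pulled back to [0, 1], the moving ends survive only inside the integrand, which is jointly
    continuous because the four other vertices stay off [[p t, q t]]. *)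
Lemma kern_param_continuous e (p q r1 r2 r3 r4 : R -> R) (t1 t2 : R) :
  (forall t, t \in `[t1, t2] ->
    [/\ {for t, continuous p} /\ {for t, continuous q}, p t < q t,
        {for t, continuous r1} /\ {for t, continuous r2},
        {for t, continuous r3} /\ {for t, continuous r4} &
        [/\ r1 t \notin `[p t, q t], r2 t \notin `[p t, q t],
            r3 t \notin `[p t, q t] & r4 t \notin `[p t, q t]]]) ->
  {in `]t1, t2[, continuous (fun t => \int[mu]_(z in `[p t, q t])
     kern e (p t) (q t) (r1 t) (r2 t) (r3 t) (r4 t) z)}.
Proof.
move=> H.
pose h (tx : R * R) := 6 * (kern_reg e (r1 tx.1) (r2 tx.1) (r3 tx.1) (r4 tx.1)
   (p tx.1 + (q tx.1 - p tx.1) * smoothstep tx.2) / smoothstep_jac tx.2).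
have ch (tx : R * R) : tx.1 \in `[t1, t2] -> tx.2 \in `[0, 1] -> {for tx, continuous h}.
  move=> t1I x1I; have [[cp cq] pq [c1 c2] [c3 c4] [n1 n2 n3 n4]] := H _ t1I.
  have c_fst (u : R -> R) : {for tx.1, continuous u} ->
      {for tx, continuous (fun tx : R * R => u tx.1)}.
    by move=> cu; apply: (@continuous_comp (R * R)%type R R fst u); [exact: cvg_fst|exact: cu].
  have cs : {for tx, continuous (fun tx : R * R => smoothstep tx.2)}.
    apply: (@continuous_comp (R * R)%type R R snd (@smoothstep R)); first exact: cvg_snd.
    exact: smoothstep_continuous.
  have cj : {for tx, continuous (fun tx : R * R => smoothstep_jac tx.2)}.
    apply: (@continuous_comp (R * R)%type R R snd (@smoothstep_jac R)); first exact: cvg_snd.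
    exact: smoothstep_jac_continuous.
  have cz : {for tx, continuous (fun tx : R * R => p tx.1 + (q tx.1 - p tx.1) * smoothstep tx.2)}.
    apply: continuous_at_add; first exact: c_fst.
    by apply: continuous_at_mul => //; apply: continuous_at_sub; exact: c_fst.
  have zin := smoothstep_itv pq x1I.
  have neq r : r \notin `[p tx.1, q tx.1] ->
      p tx.1 + (q tx.1 - p tx.1) * smoothstep tx.2 != r.
    by apply: contraNneq => <-.
  have cr (r : R -> R) : {for tx.1, continuous r} ->
     {for tx, continuous (fun tx : R * R =>
       `|p tx.1 + (q tx.1 - p tx.1) * smoothstep tx.2 - r tx.1|)}.
    by move=> c; apply: continuous_at_norm; apply: continuous_at_sub => //; exact: c_fst.
  apply: continuous_at_mul; first exact: continuous_at_cst.
  apply: continuous_at_div => //; last first.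
    by rewrite gt_eqF// (lt_le_trans _ (smoothstep_jac_ge1 x1I)).
  apply: continuous_at_div.
  - apply: continuous_at_norm; apply: continuous_at_sub => //; exact: continuous_at_cst.
  - apply: continuous_at_sqrt; apply: continuous_at_mul; apply: continuous_at_mul; exact: cr.
  - by rewrite sqrtr_eq0 -ltNge !mulr_gt0// normr_gt0 subr_eq0; exact: neq.
have eqh t : t \in `[t1, t2] -> \int[mu]_(x in `[0, 1]) h (t, x) =
    \int[mu]_(z in `[p t, q t]) kern e (p t) (q t) (r1 t) (r2 t) (r3 t) (r4 t) z.
  by move=> /H[_ pq _ _ []] *; rewrite Rintegral_kern.
move=> t tI; have := continuous_param_Rintegral ch tI.
rewrite /prop_for /continuous_at eqh; last exact: subset_itv_oo_cc.
apply: cvg_trans; apply: near_eq_cvg; near=> s.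
rewrite eqh//; apply: subset_itv_oo_cc.
by near: s; exact: near_in_itvoo.
Unshelve. all: end_near. Qed.

End kern.

(** True also when [x] or [y] vanishes, both sides being 0 then; hence the integrands are rewritten
    at every point, vertices included. *)
Lemma sqrt_divE (R : rcfType) (x y : R) : 0 <= x -> 0 <= y ->
  Num.sqrt (x / y) = x / Num.sqrt (x * y).
Proof.
move=> x0 y0; have [->|xn0] := eqVneq x 0; first by rewrite !mul0r sqrtr0.
have -> : x / y = x ^+ 2 / (x * y) by rewrite invfM expr2 -mulrA mulVKf.
by rewrite sqrtrM ?sqr_ge0// sqrtrV ?mulr_ge0// sqrtr_sqr ger0_norm.
Qed.

(** * The integrals I_k and J_k as one family, and their continuity in t *)

Section integrands.
Variables (R : realType) (a b t : R).
Notation mu := (@lebesgue_measure R).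
Implicit Types z : R.

Lemma I_integrandE z : I_integrand a b t z = kern b (- t) (- a) (- 1) 1 b t z.
Proof.
rewrite /I_integrand sqrt_divE ?mulr_ge0// /kern; congr (_ / Num.sqrt _).
by rewrite !opprK -[1 in LHS](expr1n _ 2) !subr_sqr !normrM; ring.
Qed.

Lemma J_integrandE z : J_integrand a b t z = kern (- a) (- t) (- a) (- 1) 1 b t z.
Proof.
rewrite /J_integrand sqrt_divE ?mulr_ge0// /kern opprK; congr (_ / Num.sqrt _).
by rewrite !opprK -[1 in LHS](expr1n _ 2) !subr_sqr !normrM; ring.
Qed.

End integrands.

Section pieces.
Variables (R : realType) (a b : R).
Notation mu := (@lebesgue_measure R).
Implicit Types e t z : R.

(* For 1 <= k <= 5, [piece e t k] is I_k if e = b and J_k if e = -a. *)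
Definition piece e t (k : nat) :=
  \int[mu]_(z in `[vertex a b t k, vertex a b t k.+1]) kern e (- t) (- a) (- 1) 1 b t z.

Lemma I_E t k : I_ a b t k = piece b t k.
Proof. by apply: eq_Rintegral => z _; rewrite I_integrandE. Qed.

Lemma J_E t k : J_ a b t k = piece (- a) t k.
Proof. by apply: eq_Rintegral => z _; rewrite J_integrandE. Qed.

(** Here and for intervals 4 and 5 the factors are permuted so that the ends of the interval come
    first, as [kern_integrable] and [kern_param_continuous] expect. *)
Lemma kern2E e t z :
  kern e (- t) (- a) (- 1) 1 b t z = kern e (- a) (- 1) (- t) 1 b t z.
Proof. by rewrite /kern; congr (_ / Num.sqrt _); ring. Qed.

Lemma kern4E e t z :
  kern e (- t) (- a) (- 1) 1 b t z = kern e 1 b (- t) (- a) (- 1) t z.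
Proof. by rewrite /kern; congr (_ / Num.sqrt _); ring. Qed.

Lemma kern5E e t z :
  kern e (- t) (- a) (- 1) 1 b t z = kern e b t (- t) (- a) (- 1) 1 z.
Proof. by rewrite /kern; congr (_ / Num.sqrt _); ring. Qed.

Lemma piece1E e t : piece e t 1 =
  \int[mu]_(z in `[- t, - a]) kern e (- t) (- a) (- 1) 1 b t z.
Proof. by []. Qed.

Lemma piece2E e t : piece e t 2 =
  \int[mu]_(z in `[- a, - 1]) kern e (- a) (- 1) (- t) 1 b t z.
Proof. by apply: eq_Rintegral => z _; rewrite kern2E. Qed.

Lemma piece4E e t : piece e t 4 =
  \int[mu]_(z in `[1, b]) kern e 1 b (- t) (- a) (- 1) t z.
Proof. by apply: eq_Rintegral => z _; rewrite kern4E. Qed.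

Lemma piece5E e t : piece e t 5 =
  \int[mu]_(z in `[b, t]) kern e b t (- t) (- a) (- 1) 1 z.
Proof. by apply: eq_Rintegral => z _; rewrite kern5E. Qed.

Lemma piece2_integrable e t : 1 < a -> a <= b -> b < t ->
  mu.-integrable `[- a, - 1] (EFin \o kern e (- t) (- a) (- 1) 1 b t).
Proof.
move=> a1 ab bt; rewrite (funext (kern2E e t)).
by apply: kern_integrable; [lra|itv_notin..].
Qed.

Lemma piece4_integrable e t : 1 < a -> a <= b -> b < t ->
  mu.-integrable `[1, b] (EFin \o kern e (- t) (- a) (- 1) 1 b t).
Proof.
move=> a1 ab bt; rewrite (funext (kern4E e t)).
by apply: kern_integrable; [lra|itv_notin..].
Qed.

Lemma continuous_at_opp (t : R) : {for t, continuous (@GRing.opp R)}.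
Proof. exact: oppr_continuous. Qed.

Lemma piece_continuous e k t1 t2 : 1 < a -> a <= b -> b < t1 -> k \in [:: 1; 2; 4; 5]%N ->
  {in `]t1, t2[, continuous (piece e ^~ k)}.
Proof.
move=> a1 ab bt; rewrite !inE => /or4P[] /eqP ->.
- apply: (@kern_param_continuous R e (fun t => - t) (cst (- a)) (cst (- 1)) (cst 1) (cst b) id).
  move=> s; rewrite in_itv/= => /andP[sl sr].
  by split; [split|lra|split|split|split; itv_notin];
    solve [exact: continuous_at_cst|exact: continuous_at_id|exact: continuous_at_opp].
- rewrite (funext (piece2E e)).
  apply: (@kern_param_continuous R e (cst (- a)) (cst (- 1)) (fun t => - t) (cst 1) (cst b) id).
  move=> s; rewrite in_itv/= => /andP[sl sr].
  by split; [split|lra|split|split|split; itv_notin];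
    solve [exact: continuous_at_cst|exact: continuous_at_id|exact: continuous_at_opp].
- rewrite (funext (piece4E e)).
  apply: (@kern_param_continuous R e (cst 1) (cst b) (fun t => - t) (cst (- a)) (cst (- 1)) id).
  move=> s; rewrite in_itv/= => /andP[sl sr].
  by split; [split|lra|split|split|split; itv_notin];
    solve [exact: continuous_at_cst|exact: continuous_at_id|exact: continuous_at_opp].
- rewrite (funext (piece5E e)).
  apply: (@kern_param_continuous R e (cst b) id (fun t => - t) (cst (- a)) (cst (- 1)) (cst 1)).
  move=> s; rewrite in_itv/= => /andP[sl sr].
  by split; [split|lra|split|split|split; itv_notin];
    solve [exact: continuous_at_cst|exact: continuous_at_id|exact: continuous_at_opp].
Qed.

End pieces.

(** * The integrals that produce the logarithms in the lower bounds *)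

Section logarithmic_integrals.
Variable R : realType.
Implicit Types (p q t x : R).
Notation mu := (@lebesgue_measure R).

Lemma Rintegral_derive (F f : R -> R) p q : p < q ->
  (forall x, x \in `[p, q] -> is_derive x 1 F (f x)) ->
  {in `[p, q], continuous f} ->
  \int[mu]_(x in `[p, q]) f x = F q - F p.
Proof.
move=> pq dF cf.
have cF x : x \in `[p, q] -> {for x, continuous F}.
  move=> xpq; apply/differentiable_continuous/derivable1_diffP.
  by have := dF x xpq => -[].
rewrite /Rintegral (@continuous_FTC2 _ f F)//.
- exact: continuous_within_itv.
- split.
  + by move=> x /subset_itv_oo_cc /dF[].
  + by apply: cvg_at_right_filter; apply: cF; rewrite in_itv/= lexx ltW.
  + by apply: cvg_at_left_filter; apply: cF; rewrite in_itv/= lexx ltW.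
- by move=> x /subset_itv_oo_cc xpq; rewrite derive1E; have := dF x xpq => -[].
Qed.

Lemma Rintegral_inv p q : 0 < p -> p < q ->
  mu.-integrable `[p, q] (EFin \o (fun x => x^-1)) /\
  \int[mu]_(x in `[p, q]) x^-1 = ln q - ln p.
Proof.
move=> p0 pq.
have x0 x : x \in `[p, q] -> 0 < x.
  by rewrite in_itv/= => /andP[px _]; exact: lt_le_trans px.
have cv : {in `[p, q], continuous (fun x : R => x^-1)}.
  by move=> x /x0 xp; apply: (@continuousV R R id x); [rewrite gt_eqF|exact: cvg_id].
split.
  apply: continuous_compact_integrable; first exact: segment_compact.
  exact: continuous_within_itv.
by apply: Rintegral_derive => // x /x0; exact: is_derive1_ln.
Qed.

Lemma Rintegral_inv_sub p q t : p < q -> q < t ->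
  mu.-integrable `[p, q] (EFin \o (fun x => (t - x)^-1)) /\
  \int[mu]_(x in `[p, q]) (t - x)^-1 = ln (t - p) - ln (t - q).
Proof.
move=> pq qt.
have x0 x : x \in `[p, q] -> 0 < t - x.
  by rewrite in_itv/= subr_gt0 => /andP[_ xq]; exact: le_lt_trans qt.
have cv : {in `[p, q], continuous (fun x : R => (t - x)^-1)}.
  move=> x /x0 xp; apply: (@continuousV R R (fun x => t - x) x); first by rewrite gt_eqF.
  by continuity (x : R).
split.
  apply: continuous_compact_integrable; first exact: segment_compact.
  exact: continuous_within_itv.
transitivity (- ln (t - q) - - ln (t - p)); last by rewrite opprK addrC.
apply: (@Rintegral_derive (fun x => - ln (t - x))) => // x /x0 tx.
have dl : is_derive x 1 (fun x => t - x) (- 1).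
  by apply: is_derive_eq; rewrite add0r mul1r.
have dln : is_derive (t - x) 1 (@ln R) (t - x)^-1 by exact: is_derive1_ln.
have := @is_derive1_comp R (@ln R) (fun x => t - x) x _ _ dln dl.
rewrite mulrN1 => dc; have := is_deriveN dc.
by rewrite opprK.
Qed.

End logarithmic_integrals.

(** * Reduction of bounds on the integrands to polynomial inequalities *)

Section kern_bounds.
Variable R : realType.
Implicit Types (e p q r x z L M : R).

Lemma kern_reg_le e r1 r2 r3 r4 z M : 0 <= M ->
  `|z - e| ^+ 2 <= M ^+ 2 * (`|z - r1| * `|z - r2| * (`|z - r3| * `|z - r4|)) ->
  kern_reg e r1 r2 r3 r4 z <= M.
Proof.
rewrite /kern_reg; set D := `|z - r1| * _ * _ => M0 h.
have D0 : 0 <= D by rewrite /D !mulr_ge0.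
have [->|Dn0] := eqVneq D 0; first by rewrite sqrtr0 invr0 mulr0.
have Dp : 0 < D by rewrite lt_neqAle eq_sym Dn0.
rewrite ler_pdivrMr ?sqrtr_gt0// -(@ler_pXn2r _ 2)// ?nnegrE ?mulr_ge0 ?sqrtr_ge0//.
by rewrite exprMn sqr_sqrtr.
Qed.

(** Unlike in [kern_reg_le], the denominator has to be positive: where it vanishes the quotient is
    0, which is harmless for an upper bound but not for a lower one. *)
Lemma kern_ge e p q r1 r2 r3 r4 z (m : R) : 0 <= m ->
  0 < `|z - p| * `|z - q| * (`|z - r1| * `|z - r2| * (`|z - r3| * `|z - r4|)) ->
  m ^+ 2 * (`|z - p| * `|z - q| * (`|z - r1| * `|z - r2| * (`|z - r3| * `|z - r4|)))
    <= `|z - e| ^+ 2 ->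
  m <= kern e p q r1 r2 r3 r4 z.
Proof.
rewrite /kern; set D := `|z - p| * _ * _ => m0 Dp h.
rewrite ler_pdivlMr ?sqrtr_gt0// -(@ler_pXn2r _ 2)// ?nnegrE ?mulr_ge0 ?sqrtr_ge0//.
by rewrite exprMn sqr_sqrtr// ltW.
Qed.

End kern_bounds.

Section kern_integral_bounds.
Variable R : realType.
Notation mu := (@lebesgue_measure R).
Implicit Types (a b e t z : R).

Lemma piece_ge0 a b e t k : 0 <= piece a b e t k.
Proof. by apply: Rintegral_ge0 => z _; exact: kern_ge0. Qed.

Lemma Rintegral_kern_le e p q r1 r2 r3 r4 (M : R) : p < q -> 0 <= M ->
  mu.-integrable `[p, q] (EFin \o kern e p q r1 r2 r3 r4) ->
  {in `]p, q[, forall z, kern_reg e r1 r2 r3 r4 z <= M} ->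
  \int[mu]_(z in `[p, q]) kern e p q r1 r2 r3 r4 z <= 6 * M.
Proof.
move=> pq M0 ik kM; apply: Rintegral_le_arcsine => // z zpq.
by rewrite kernE ler_wpM2r ?invr_ge0 ?sqrtr_ge0// kM.
Qed.

End kern_integral_bounds.

Ltac unfold_norms := repeat
  match goal with |- context [Num.norm ?x] =>
    first [ rewrite (@ger0_norm _ x); [|lra] | rewrite (@ler0_norm _ x); [|lra] ] end.

Lemma ler_mul4 (R : realDomainType) (x1 x2 x3 x4 y1 y2 y3 y4 : R) :
  0 <= x1 <= y1 -> 0 <= x2 <= y2 -> 0 <= x3 <= y3 -> 0 <= x4 <= y4 ->
  x1 * x2 * (x3 * x4) <= y1 * y2 * (y3 * y4).
Proof.
move=> /andP[? ?] /andP[? ?] /andP[? ?] /andP[? ?].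
by rewrite !ler_pM// !mulr_ge0.
Qed.

Lemma ler_mul6 (R : realDomainType) (x1 x2 x3 x4 x5 x6 y1 y2 y3 y4 y5 y6 : R) :
  0 <= x1 <= y1 -> 0 <= x2 <= y2 -> 0 <= x3 <= y3 -> 0 <= x4 <= y4 ->
  0 <= x5 <= y5 -> 0 <= x6 <= y6 ->
  0 <= x1 * x2 * (x3 * x4 * (x5 * x6)) <= y1 * y2 * (y3 * y4 * (y5 * y6)).
Proof.
move=> /andP[? ?] /andP[? ?] /andP[? ?] /andP[? ?] /andP[? ?] /andP[? ?].
by rewrite !mulr_ge0//= !ler_pM// !mulr_ge0.
Qed.

Ltac lra6 := apply: ler_mul6; apply/andP; split; lra.

Ltac lra4 := apply: ler_mul4; apply/andP; split; lra.

(** * Estimates for t close to b *)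

Section near_b_bounds.
Variables (R : realType) (a b t : R).
Notation mu := (@lebesgue_measure R).

(** Because a < b, the vertices - t and - a stay at distance at least b - a while t tends to b. The
    constant [M] stands in for 1 / sqrt (b - a). *)
Lemma piece2_le (M : R) : 1 < a -> a < b -> b < t -> 0 <= M -> 1 <= M ^+ 2 * (b - a) ->
  piece a b b t 2 <= 6 * M.
Proof.
move=> a1 ab bt M0 hM; rewrite piece2E.
apply: Rintegral_kern_le => //; [lra| |].
  by apply: kern_integrable; [lra|itv_notin..].
move=> z; rewrite in_itv/= => /andP[z1 z2]; apply: kern_reg_le => //.
unfold_norms.
apply: (@le_trans _ _ (M ^+ 2 * ((b - a) * 1 * ((b - z) * (b - z))))).
  rewrite mulr1 mulrA sqrrN (_ : (z - b) ^+ 2 = (b - z) * (b - z)); last by ring.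
  by rewrite ler_peMl// -expr2 sqr_ge0.
by rewrite ler_wpM2l ?sqr_ge0//; lra4.
Qed.

(** The numerator b - z is at most t - z, so it tames the collision of b with t; J_4 has no such
    factor and diverges. *)
Lemma piece4_le : 1 < a -> a < b -> b < t -> piece a b b t 4 <= 6.
Proof.
move=> a1 ab bt; rewrite piece4E -[leRHS]mulr1.
apply: Rintegral_kern_le => //; [lra| |].
  by apply: kern_integrable; [lra|itv_notin..].
move=> z; rewrite in_itv/= => /andP[z1 z2]; apply: kern_reg_le => //.
unfold_norms.
rewrite expr1n mul1r (_ : (- (z - b)) ^+ 2 = (b - z) * 1 * (1 * (b - z))); last by ring.
by lra4.
Qed.

Lemma piece1_le : 1 < a -> a < b -> b < t -> piece a b (- a) t 1 <= 6.
Proof.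
move=> a1 ab bt; rewrite piece1E -[leRHS]mulr1.
apply: Rintegral_kern_le => //; [lra| |].
  by apply: kern_integrable; [lra|itv_notin..].
move=> z; rewrite in_itv/= => /andP[z1 z2]; apply: kern_reg_le => //.
unfold_norms.
rewrite expr1n mul1r (_ : _ ^+ 2 = (- a - z) * (- a - z) * (1 * 1)); last by ring.
by lra4.
Qed.

(** Both ends of [b, t] merge, but the arcsine kernel has the same integral over intervals of any
    length, so only the remaining factor needs a bound. *)
Lemma piece5_le (M : R) : 1 < a -> a < b -> b < t -> 0 <= M -> 1 <= M ^+ 2 * (b - 1) ->
  piece a b (- a) t 5 <= 6 * M.
Proof.
move=> a1 ab bt M0 hM; rewrite piece5E.
apply: Rintegral_kern_le => //.
  by apply: kern_integrable; [lra|itv_notin..].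
move=> z; rewrite in_itv/= => /andP[z1 z2]; apply: kern_reg_le => //.
unfold_norms.
apply: (@le_trans _ _ (M ^+ 2 * ((z + a) * (z + a) * (1 * (b - 1))))).
  rewrite mul1r mulrCA (_ : (z - - a) ^+ 2 = (z + a) * (z + a)); last by ring.
  by rewrite ler_peMr// -expr2 sqr_ge0.
by rewrite ler_wpM2l ?sqr_ge0//; lra4.
Qed.

(** The interval [-b, -a] lies in [-t, -a] for every t > b. On it the numerator is at least 1 and
    each of the six distances is at most 2 b + 1. *)
Lemma piece1_ge : 1 < a -> a < b -> b < t -> t <= b + 1 ->
  (b - a) / (2 * b + 1) ^+ 3 <= piece a b b t 1.
Proof.
move=> a1 ab bt tb; rewrite piece1E.
have L0 : 0 < 2 * b + 1 by lra.
rewrite mulrC (_ : b - a = - a - - b); last by ring.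
apply: Rintegral_ge_cst; [lra|lra|lra| | |].
- by apply: kern_integrable; [lra|itv_notin..].
- by move=> z _; exact: kern_ge0.
move=> z; rewrite in_itv/= => /andP[z1 z2].
apply: kern_ge; first by rewrite invr_ge0 exprn_ge0 ?ltW.
  by rewrite !mulr_gt0// normr_gt0 subr_eq0; apply/eqP => h; lra.
unfold_norms.
rewrite exprVn mulrC ler_pdivrMr ?exprn_gt0//.
have -> (L : R) : (L ^+ 3) ^+ 2 = L * L * (L * L * (L * L)) by ring.
set W := _ * _ * (_ * _ * _); set W' := (2 * b + 1) * _ * _.
have /andP[W0 WW'] : 0 <= W <= W' by lra6.
by rewrite (le_trans WW')// ler_peMl ?(le_trans W0)//; nra.
Qed.

(** Both b - z and t - z are at most t - z, so the square root of their product is too; the other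
    four distances are at most 2 b + 1. The integrand thus dominates a multiple of 1 / (t - z). *)
Lemma piece4_ge : 1 < a -> a < b -> b < t -> t <= b + 1 ->
  (ln (b - 1) - ln (t - b)) / (2 * b + 1) ^+ 2 <= piece a b (- a) t 4.
Proof.
move=> a1 ab bt tb; rewrite piece4E.
have L0 : 0 < 2 * b + 1 by lra.
have b1 : 1 < b by lra.
have [iv vE] := Rintegral_inv_sub b1 bt.
apply: (@le_trans _ _ ((ln (t - 1) - ln (t - b)) / (2 * b + 1) ^+ 2)).
  apply: ler_wpM2r; first by rewrite invr_ge0 exprn_ge0 ?ltW.
  by rewrite lerD2r ler_ln ?posrE; lra.
rewrite -vE -RintegralZr//.
apply: le_Rintegral_itv.
- exact: (integrableZr _ _ iv).
- by apply: kern_integrable; [lra|itv_notin..].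
move=> z; rewrite in_itv/= => /andP[z1 z2].
have tz : 0 < t - z by lra.
apply: kern_ge; first by rewrite mulr_ge0 ?invr_ge0 ?exprn_ge0 ?ltW.
  by rewrite !mulr_gt0// normr_gt0 subr_eq0; apply/eqP => h; lra.
unfold_norms.
rewrite -invfM exprVn mulrC ler_pdivrMr ?exprn_gt0 ?mulr_gt0 ?exprn_gt0//.
have -> (L : R) : ((t - z) * L ^+ 2) ^+ 2 = L * (t - z) * (L * L * (L * (t - z))) by ring.
set W := _ * _ * (_ * _ * _); set W' := (2 * b + 1) * _ * _.
have /andP[W0 WW'] : 0 <= W <= W' by lra6.
by rewrite (le_trans WW')// ler_peMl ?(le_trans W0)//; nra.
Qed.

End near_b_bounds.

Lemma exists_sqr_ge (R : realFieldType) (d : R) : 0 < d ->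
  exists2 M : R, 0 <= M & 1 <= M ^+ 2 * d.
Proof.
move=> d0; exists (d^-1 + 1); first by rewrite addr_ge0// invr_ge0 ltW.
rewrite (_ : _ * d = d^-1 + 2 + d); last by field; rewrite gt_eqF.
by rewrite -addrA ler_wpDl ?invr_ge0 ?ltW//; lra.
Qed.

Lemma near_b_sign (R : realType) (a b : R) : 1 < a -> a < b ->
  exists t, [/\ b < t, t <= b + 1 &
    (piece a b (- a) t 1 + piece a b (- a) t 5) * (piece a b b t 2 + piece a b b t 4) <
    (piece a b b t 1 + piece a b b t 5) * (piece a b (- a) t 2 + piece a b (- a) t 4)].
Proof.
move=> a1 ab.
have [M2 M20 hM2] := exists_sqr_ge (ltac:(lra) : 0 < b - a).
have [M5 M50 hM5] := exists_sqr_ge (ltac:(lra) : 0 < b - 1).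
set L := 2 * b + 1.
have L0 : 0 < L by rewrite /L; lra.
(* [K] bounds (J_1 + J_5) (I_2 + I_4) from above, and c (ln (b - 1) + T) bounds I_1 J_4 from below
   when t - b = exp (- T). *)
pose K := (6 + 6 * M5) * (6 * M2 + 6).
pose c := (b - a) / L ^+ 3 / L ^+ 2.
have c0 : 0 < c by rewrite !divr_gt0 ?exprn_gt0//; lra.
(* Makes K < c (ln (b - 1) + T); the absolute value also keeps T >= 0, hence t <= b + 1. *)
pose T := `|K / c - ln (b - 1)| + 1.
have T0 : 0 <= T by rewrite addr_ge0.
have e1 : expR (- T) <= 1 by rewrite -[leRHS]expR0 ler_expR; lra.
have e0 := expR_gt0 (- T).
exists (b + expR (- T)).
set t := b + _.
have bt : b < t by rewrite /t; lra.
have tb : t <= b + 1 by rewrite /t; lra.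
split => //.
have := piece1_ge a1 ab bt tb; have := piece4_ge a1 ab bt tb.
have -> : ln (t - b) = - T by rewrite /t addrC addKr expRK.
rewrite -/L opprK => h4 h1.
have h2 := piece2_le a1 ab bt M20 hM2; have h5 := piece5_le a1 ab bt M50 hM5.
have h4' := piece4_le a1 ab bt; have h1' := piece1_le a1 ab bt.
have KT : K < c * (ln (b - 1) + T).
  rewrite mulrC -ltr_pdivrMr// -ltrBlDl /T ltr_pwDr//; exact: ler_norm.
apply: (@le_lt_trans _ _ K).
  by apply: ler_pM; rewrite ?addr_ge0 ?piece_ge0// lerD.
apply: (lt_le_trans KT).
have -> : c * (ln (b - 1) + T) = (b - a) / L ^+ 3 * ((ln (b - 1) + T) / L ^+ 2).
  by rewrite /c; ring.
have K0 : 0 <= K by rewrite mulr_ge0// addr_ge0// mulr_ge0.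
apply: ler_pM.
- by rewrite divr_ge0 ?exprn_ge0 ?ltW//; lra.
- rewrite divr_ge0 ?exprn_ge0 ?(ltW L0)// -(pmulr_rge0 _ c0).
  by rewrite ltW// (le_lt_trans K0).
- by rewrite (le_trans h1)// lerDl piece_ge0.
- by rewrite (le_trans h4)// lerDr piece_ge0.
Qed.

(** * The limiting elliptic integrals and their comparison *)

Section genus_one.
Variable R : realType.
Implicit Types (e p q r a b x z : R).
Notation mu := (@lebesgue_measure R).

Lemma kern_reg_integrable e p q r3 r4 : p < q ->
  r3 \notin `[p, q] -> r4 \notin `[p, q] ->
  mu.-integrable `[p, q] (EFin \o kern_reg e p q r3 r4).
Proof.
move=> pq n3 n4.
rewrite (_ : kern_reg _ _ _ _ _ = fun z =>
    (`|z - e| / Num.sqrt (`|z - r3| * `|z - r4|)) / Num.sqrt (`|z - p| * `|z - q|)); last first.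
  apply/funext => z.
  by rewrite /kern_reg sqrtrM ?mulr_ge0// invfM -!mulrA [_^-1 * _^-1]mulrC.
apply: arcsine_kernel_integrable => //.
- move=> z zpq; continuity (z : R).
  have neq r : r \notin `[p, q] -> z != r by apply: contraNneq => <-.
  by rewrite sqrtr_eq0 -ltNge !mulr_gt0// normr_gt0 subr_eq0 neq.
Qed.

Section moebius.
Variables a b : R.

(* The Moebius transformation of [1, b] onto [1, a] such that x |-> - moebius x
   permutes the zeros of (z - b) (z + a) (z ^ 2 - 1); it preserves the
   holomorphic differential of the elliptic curve they define. *)
Definition moebius x := ((b - a) + (a * b - 1) * x) / ((b - a) * x + (a * b - 1)).

(** The numerator is the determinant (a b - 1)^2 - (b - a)^2 of the transformation. *)
Definition dmoebius x :=
  ((a ^+ 2 - 1) * (b ^+ 2 - 1)) / ((b - a) * x + (a * b - 1)) ^+ 2.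

Lemma moebius_den_gt0 x : 1 < a -> a < b -> 1 <= x ->
  0 < (b - a) * x + (a * b - 1).
Proof. nra. Qed.

Lemma is_derive_moebius x : 1 < a -> a < b -> 1 <= x ->
  is_derive x 1 moebius (dmoebius x).
Proof.
move=> a1 ab x1; have d0 := moebius_den_gt0 a1 ab x1; rewrite /moebius /dmoebius.
have dn : is_derive x 1 (fun x => (b - a) + (a * b - 1) * x) (a * b - 1).
  by apply: is_derive_eq; rewrite /GRing.scale /=; ring.
have dd : is_derive x 1 (fun x => (b - a) * x + (a * b - 1)) (b - a).
  by apply: is_derive_eq; rewrite /GRing.scale /=; ring.
have dv := @is_deriveV _ (fun x => (b - a) * x + (a * b - 1)) x _ _ (lt0r_neq0 d0) dd.
apply: (is_derive_eq (is_deriveM dn dv)).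
rewrite /GRing.scale /=; field.
by rewrite lt0r_neq0.
Qed.

Lemma moebius_continuous x : 1 < a -> a < b -> 1 <= x -> {for x, continuous moebius}.
Proof.
move=> a1 ab x1; rewrite /moebius; continuity (x : R).
by rewrite lt0r_neq0// moebius_den_gt0.
Qed.

Lemma moebius_add_continuous e x : 1 < a -> a < b -> 1 <= x ->
  {for x, continuous (fun x => `|moebius x + e|)}.
Proof.
move=> a1 ab x1; apply: continuous_at_norm; apply: continuous_at_add.
  exact: moebius_continuous.
exact: continuous_at_cst.
Qed.

Lemma dmoebius_continuous x : 1 < a -> a < b -> 1 <= x -> {for x, continuous dmoebius}.
Proof.
move=> a1 ab x1; rewrite /dmoebius expr2; continuity (x : R).
by rewrite mulf_neq0// lt0r_neq0// moebius_den_gt0.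
Qed.

Lemma dmoebius_gt0 x : 1 < a -> a < b -> 1 <= x -> 0 < dmoebius x.
Proof.
move=> a1 ab x1; rewrite /dmoebius divr_gt0 ?exprn_gt0 ?moebius_den_gt0//.
by rewrite mulr_gt0//; nra.
Qed.

(** The constants on the right multiply to ((a^2 - 1) (b^2 - 1))^2, so the product of the four
    equations is, up to sign, the quartic at x times [dmoebius x ^+ 2]: this is the invariance of dz
    / y. *)
Lemma moebius_factors x : 1 < a -> a < b -> 1 <= x ->
  let D := (b - a) * x + (a * b - 1) in
  [/\ moebius x - 1 = (a - 1) * (b + 1) * (x - 1) / D,
      moebius x + 1 = (a + 1) * (b - 1) * (x + 1) / D,
      a - moebius x = (a ^+ 2 - 1) * (b - x) / D &
      moebius x + b = (b ^+ 2 - 1) * (x + a) / D].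
Proof.
move=> a1 ab x1 D; have D0 : D != 0 by rewrite lt0r_neq0// moebius_den_gt0.
by split; rewrite /moebius /D; field; exact: D0.
Qed.

Lemma moebius_pullback e x : 1 < a -> a < b -> x \in `]1, b[ ->
  kern_reg e 1 b (- 1) (- a) (- moebius x) * dmoebius x =
  `|moebius x + e| / Num.sqrt (`|x - 1| * `|x - b| * (`|x - - 1| * `|x - - a|)).
Proof.
move=> a1 ab; rewrite in_itv/= => /andP[x1 xb].
have D0 := moebius_den_gt0 a1 ab (ltW x1).
have [f1 f2 f3 f4] := moebius_factors a1 ab (ltW x1).
have p1 : 0 < a ^+ 2 - 1 by nra.
have p2 : 0 < b ^+ 2 - 1 by nra.
have m0 := dmoebius_gt0 a1 ab (ltW x1).
rewrite /kern_reg -opprD normrN.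
set V := `|- moebius x - 1| * _ * _; set W := `|x - 1| * _ * _.
have VE : V = dmoebius x ^+ 2 * W.
  rewrite /V /W -!normrM -[dmoebius x ^+ 2]ger0_norm ?sqr_ge0// -normrM; congr `|_|.
  rewrite !opprK.
  rewrite (_ : - moebius x - 1 = - (moebius x + 1)); last by ring.
  rewrite (_ : - moebius x - b = - (moebius x + b)); last by ring.
  rewrite (_ : - moebius x + 1 = - (moebius x - 1)); last by ring.
  rewrite (_ : - moebius x + a = a - moebius x); last by ring.
  rewrite f1 f2 f3 f4 /dmoebius; field.
  by rewrite lt0r_neq0.
have W0 : 0 < Num.sqrt W.
  by rewrite sqrtr_gt0 /W !mulr_gt0// normr_gt0 subr_eq0; apply/eqP => ?; lra.
rewrite VE sqrtrM ?sqr_ge0// sqrtr_sqr (gtr0_norm m0).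
by field; rewrite !lt0r_neq0.
Qed.

(** This is A_I for [e = b] and A_J for [e = - a]. *)
Definition inner_limit e :=
  \int[mu]_(z in `[- a, - 1]) kern_reg e 1 b (- 1) (- a) z +
  \int[mu]_(z in `[1, b]) kern_reg e 1 b (- 1) (- a) z.

Let W x := Num.sqrt (`|x - 1| * `|x - b| * (`|x - - 1| * `|x - - a|)).

Lemma moebius_pullback_integrable e : 1 < a -> a < b ->
  mu.-integrable `[1, b] (EFin \o (fun x => `|moebius x + e| / W x)).
Proof.
move=> a1 ab.
rewrite (_ : (fun x => _) = fun x =>
    (`|moebius x + e| / Num.sqrt (`|x - - 1| * `|x - - a|)) /
    Num.sqrt (`|x - 1| * `|x - b|)); last first.
  by apply/funext => x; rewrite /W sqrtrM ?mulr_ge0// invfM -!mulrA [_^-1 * _^-1]mulrC.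
apply: arcsine_kernel_integrable; first lra.
- move=> x; rewrite in_itv/= => /andP[x1 xb].
  apply: (@continuous_at_div _ _ x); [exact: moebius_add_continuous|by continuity (x : R)|].
  by rewrite sqrtr_eq0 -ltNge !mulr_gt0// normr_gt0 subr_eq0; apply/eqP => ?; lra.
- by move=> z _; rewrite divr_ge0 ?sqrtr_ge0.
Qed.

Lemma inner_limitE e : 1 < a -> a < b ->
  inner_limit e = \int[mu]_(x in `[1, b]) (`|moebius x + e| / W x + `|x - e| / W x).
Proof.
move=> a1 ab; have b1 : 1 < b by lra.
rewrite RintegralD//; [|exact: moebius_pullback_integrable|]; last first.
  by apply: kern_reg_integrable => //; rewrite in_itv/=; apply/negP => /andP[]; lra.
congr +%R.
(* The reflection is split off first: what is left of the transformation, [moebius] from [1, b] onto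
   [1, a], is increasing, as [ge0_substitution] requires. *)
pose u (y : R) := kern_reg e 1 b (- 1) (- a) (- y).
have uc : {in `]1, a[, continuous u}.
  move=> y; rewrite in_itv/= => /andP[y1 ya].
  apply: (@continuous_comp R R R -%R (kern_reg e 1 b (- 1) (- a))).
    exact: oppr_continuous.
  by apply: kern_reg_continuous; apply/eqP => ?; lra.
have u0 : {in `]1, a[, forall y, 0 <= u y} by move=> y _; exact: kern_reg_ge0.
transitivity (\int[mu]_(z in `[- a, - 1]) u (- z)).
  by apply: eq_Rintegral => z _; rewrite /u opprK.
rewrite Rintegral_oppr// /Rintegral; congr fine.
have F1 : moebius 1 = 1 by rewrite /moebius; field; apply/eqP => ?; nra.
have Fb : moebius b = a by rewrite /moebius; field; apply/eqP => ?; nra.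
have := @ge0_substitution R moebius dmoebius u (fun x => `|moebius x + e| / W x) 1 b b1.
rewrite F1 Fb; apply.
- by move=> x; rewrite in_itv/= => /andP[x1 _]; exact: is_derive_moebius.
- by move=> x; rewrite in_itv/= => /andP[x1 _]; exact: dmoebius_continuous.
- by move=> x; rewrite in_itv/= => /andP[x1 _]; apply: dmoebius_gt0 => //; exact: ltW.
- exact: uc.
- exact: u0.
- move=> x; rewrite in_itv/= => /andP[x1 xb].
  apply: (@continuous_at_div _ _ x); [|by rewrite /W; continuity (x : R)|].
    by apply: moebius_add_continuous => //; exact: ltW.
  by rewrite /W sqrtr_eq0 -ltNge !mulr_gt0// normr_gt0 subr_eq0; apply/eqP => ?; lra.
- by move=> x xI; rewrite /u moebius_pullback.
Qed.

(** On [1, b] all absolute values have a fixed sign, and with m = [moebius x] the integrands differ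
    by 2 ((b - x) - (a - m)) / W. Here a - m = (a^2 - 1) (b - x) / D, and D exceeds a^2 - 1 by (b -
    a) (x + a), so the difference is nonnegative, and positive for 1 < x < b. *)
Lemma inner_limit_lt : 1 < a -> a < b -> inner_limit (- a) < inner_limit b.
Proof.
move=> a1 ab; have b1 : 1 < b by lra.
rewrite -subr_gt0 !inner_limitE//.
have ik e : mu.-integrable `[1, b]
    (EFin \o (fun x => `|moebius x + e| / W x + `|x - e| / W x)).
  apply: (@integrableD _ _ _ mu _ _ (EFin \o (fun x => `|moebius x + e| / W x))
    (EFin \o (fun x => `|x - e| / W x))) => //; first exact: moebius_pullback_integrable.
  by apply: kern_reg_integrable => //; rewrite in_itv/=; apply/negP => /andP[]; lra.
rewrite -RintegralB//.
have diffE x : x \in `[1, b] ->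
   `|moebius x + b| / W x + `|x - b| / W x - (`|moebius x + - a| / W x + `|x - - a| / W x) =
   2 * ((b - x) * ((b - a) * (x + a)) / ((b - a) * x + (a * b - 1))) / W x.
  rewrite in_itv/= => /andP[x1 xb].
  have D0 := moebius_den_gt0 a1 ab x1.
  have [f1 f2 f3 f4] := moebius_factors a1 ab x1.
  rewrite -2!mulrDl -mulrBl; congr (_ / _).
  rewrite (@ger0_norm _ (moebius x + b)); last first.
    by rewrite f4 divr_ge0 ?(ltW D0)// mulr_ge0//; nra.
  rewrite (@ler0_norm _ (moebius x + - a)); last first.
    by rewrite -oppr_ge0 opprB f3 divr_ge0 ?(ltW D0)// mulr_ge0//; nra.
  rewrite (@ler0_norm _ (x - b)) ?(@ger0_norm _ (x - - a)); [|lra|lra].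
  rewrite /moebius; field.
  by rewrite lt0r_neq0.
(* A lower bound for the difference on the left half of [1, b], where 2 (b - x) >= b - 1 and x + a
   >= 1; D is largest at b, and W is at most (2 b)^2. This makes the inequality of integrals
   strict. *)
pose c := (b - 1) * (b - a) / ((b - a) * b + (a * b - 1)) / (2 * b) ^+ 2.
have Db := moebius_den_gt0 a1 ab (ltW b1).
have c0 : 0 < c.
  by rewrite !divr_gt0 ?exprn_gt0// ?mulr_gt0//; lra.
apply: (@lt_le_trans _ _ (c * ((1 + b) / 2 - 1))); first by rewrite mulr_gt0//; lra.
apply: Rintegral_ge_cst; [by []|lra|lra| | |].
- apply: (@integrableB _ _ _ mu _ _ (EFin \o _) (EFin \o _)) => //; exact: ik.
- move=> x xI; rewrite diffE// divr_ge0 ?sqrtr_ge0//.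
  move: xI; rewrite in_itv/= => /andP[x1 xb].
  rewrite mulr_ge0// divr_ge0 ?(ltW (moebius_den_gt0 a1 ab x1))//.
  by rewrite !mulr_ge0//; lra.
- move=> x; rewrite in_itv/= => /andP[x1 xb].
  rewrite diffE; last by rewrite in_itv/=; apply/andP; split; lra.
  have D0 := moebius_den_gt0 a1 ab (ltW x1).
  have W0 : 0 < W x.
    by rewrite /W sqrtr_gt0 !mulr_gt0// normr_gt0 subr_eq0; apply/eqP => ?; lra.
  have Wb : W x <= (2 * b) ^+ 2.
    rewrite -[leRHS]ger0_norm ?sqr_ge0// -sqrtr_sqr /W; apply: ler_wsqrtr.
    have -> : ((2 * b) ^+ 2) ^+ 2 = 2 * b * (2 * b) * (2 * b * (2 * b)) by ring.
    by unfold_norms; lra4.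
  rewrite /c; apply: ler_pM.
  + by rewrite divr_ge0 ?(ltW Db)// mulr_ge0//; lra.
  + by rewrite invr_ge0 exprn_ge0//; lra.
  + rewrite mulrA; apply: ler_pM.
    * by rewrite mulr_ge0//; lra.
    * by rewrite invr_ge0 ltW.
    * by rewrite mulrA; apply: ler_pM; [lra|lra|lra|rewrite ler_peMr; lra].
    * by rewrite lef_pV2 ?posrE// lerD2r ler_wpM2l//; lra.
  + by rewrite lef_pV2 ?posrE// exprn_gt0//; lra.
Qed.

End moebius.
End genus_one.

(** * The symmetry z |-> - z *)

Section reflection.
Variable R : realType.
Implicit Types (a b e p q t z : R).
Notation mu := (@lebesgue_measure R).

Lemma kern_oppr e p q r1 r2 r3 r4 z :
  kern e (- p) (- q) (- r1) (- r2) (- r3) (- r4) (- z) =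
  kern (- e) q p r1 r2 r3 r4 z.
Proof.
rewrite /kern; have h r : `|- z - - r| = `|z - r| by rewrite -opprD normrN.
by rewrite !h -(h (- e)) opprK (mulrC `|z - p|).
Qed.

Lemma Rintegral_kern_oppr e p q r1 r2 r3 r4 : p < q ->
  r1 \notin `[p, q] -> r2 \notin `[p, q] -> r3 \notin `[p, q] -> r4 \notin `[p, q] ->
  \int[mu]_(z in `[- q, - p]) kern e (- q) (- p) (- r1) (- r2) (- r3) (- r4) z =
  \int[mu]_(z in `[p, q]) kern (- e) p q r1 r2 r3 r4 z.
Proof.
move=> pq h1 h2 h3 h4; rewrite -Rintegral_oppr//.
- by apply: eq_Rintegral => z _; rewrite -kern_oppr opprK.
- exact: kern_continuous_itv.
- by move=> z _; exact: kern_ge0.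
Qed.

Lemma piece1_oppr a b e t : 1 < a -> a <= b -> b < t ->
  piece a b e t 1 = \int[mu]_(z in `[a, t]) kern (- e) a t 1 (- 1) (- b) (- t) z.
Proof.
move=> a1 ab bt; rewrite piece1E -Rintegral_kern_oppr; [|lra|itv_notin..].
by rewrite !opprK.
Qed.

Lemma piece2_oppr a b e t : 1 < a -> a <= b -> b < t ->
  piece a b e t 2 = \int[mu]_(z in `[1, a]) kern (- e) 1 a t (- 1) (- b) (- t) z.
Proof.
move=> a1 ab bt; rewrite piece2E -Rintegral_kern_oppr; [|lra|itv_notin..].
by rewrite !opprK.
Qed.

Lemma piece_swap15 a e t : 1 < a -> a < t -> piece a a e t 1 = piece a a (- e) t 5.
Proof.
move=> a1 at_; rewrite piece1_oppr// piece5E; apply: eq_Rintegral => z _.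
by rewrite /kern; congr (_ / Num.sqrt _); ring.
Qed.

Lemma piece_swap24 a e t : 1 < a -> a < t -> piece a a e t 2 = piece a a (- e) t 4.
Proof.
move=> a1 at_; rewrite piece2_oppr// piece4E; apply: eq_Rintegral => z _.
by rewrite /kern; congr (_ / Num.sqrt _); ring.
Qed.

End reflection.

Lemma le_div_sqrt (R : rcfType) (x y u v : R) : 0 <= y -> 0 < u -> 0 < v ->
  x ^+ 2 * v <= y ^+ 2 * u -> x / Num.sqrt u <= y / Num.sqrt v.
Proof.
move=> y0 u0 v0 h.
rewrite ler_pdivrMr ?sqrtr_gt0// mulrAC ler_pdivlMr ?sqrtr_gt0//.
apply: (@le_trans _ _ `|x * Num.sqrt v|); first exact: ler_norm.
rewrite -(@ler_pXn2r _ 2)// ?nnegrE ?mulr_ge0 ?sqrtr_ge0//.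
by rewrite real_normK ?num_real// !exprMn (sqr_sqrtr (ltW u0)) (sqr_sqrtr (ltW v0)).
Qed.

Ltac norm_prod_gt0 := rewrite !mulr_gt0// normr_gt0 subr_eq0; apply/eqP => ?; lra.

(** * Estimates for large t *)

Section large_t.
Variables (R : realType) (a b : R).
Notation mu := (@lebesgue_measure R).
Implicit Types (e p q t z : R).

(** The two factors that contain t multiply to t^2 - z^2, which lies between (t - b)^2 and t^2 when
    |z| <= b. *)
Lemma kern_inner_bounds e t z : b < t -> z \in `[- b, b] ->
  kern_reg e 1 b (- 1) (- a) z / t <= kern e (- t) (- a) (- 1) 1 b t z
    <= kern_reg e 1 b (- 1) (- a) z / (t - b).
Proof.
rewrite in_itv/= => bt /andP[z1 z2].
have -> : kern e (- t) (- a) (- 1) 1 b t z = kern e (- t) t 1 b (- 1) (- a) z.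
  by rewrite /kern; congr (_ / Num.sqrt _); ring.
have tb : 0 < t - b by lra.
have -> : kern e (- t) t 1 b (- 1) (- a) z = kern_reg e 1 b (- 1) (- a) z / Num.sqrt ((t + z) * (t - z)).
  rewrite kernE; congr (_ / Num.sqrt _).
  by rewrite (@ger0_norm _ (z - - t)) ?(@ler0_norm _ (z - t)); [ring|lra|lra].
have s1 : t - b <= Num.sqrt ((t + z) * (t - z)).
  by rewrite -[leLHS](ger0_norm (ltW tb)) -sqrtr_sqr ler_wsqrtr//; nra.
have s2 : Num.sqrt ((t + z) * (t - z)) <= t.
  have t0 : 0 <= t by lra.
  by rewrite -[leRHS](ger0_norm t0) -sqrtr_sqr ler_wsqrtr//; nra.
by rewrite !ler_wpM2l ?kern_reg_ge0// lef_pV2// posrE; lra.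
Qed.

Lemma Rintegral_inner_bounds e p q t : - b <= p -> q <= b -> b < t ->
  mu.-integrable `[p, q] (EFin \o kern_reg e 1 b (- 1) (- a)) ->
  mu.-integrable `[p, q] (EFin \o kern e (- t) (- a) (- 1) 1 b t) ->
  \int[mu]_(z in `[p, q]) kern_reg e 1 b (- 1) (- a) z / t <=
  \int[mu]_(z in `[p, q]) kern e (- t) (- a) (- 1) 1 b t z <=
  \int[mu]_(z in `[p, q]) kern_reg e 1 b (- 1) (- a) z / (t - b).
Proof.
move=> bp qb bt ir ik; rewrite -!RintegralZr//.
have kb z : z \in `]p, q[ -> z \in `[- b, b].
  by rewrite !in_itv/= => /andP[? ?]; apply/andP; split; lra.
have iZ (c : R) : mu.-integrable `[p, q] (EFin \o (fun z => kern_reg e 1 b (- 1) (- a) z * c)).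
  exact: (integrableZr _ _ ir).
by apply/andP; split; apply: le_Rintegral_itv => // z /kb /(kern_inner_bounds e bt)/andP[].
Qed.

Lemma inner_bounds e t : 1 < a -> a < b -> b < t ->
  inner_limit a b e / t <= piece a b e t 2 + piece a b e t 4 <=
  inner_limit a b e / (t - b).
Proof.
move=> a1 ab bt.
have i2 : mu.-integrable `[- a, - 1] (EFin \o kern_reg e 1 b (- 1) (- a)).
  rewrite (_ : kern_reg _ _ _ _ _ = kern_reg e (- a) (- 1) 1 b); last first.
    by apply/funext => z; rewrite /kern_reg; congr (_ / Num.sqrt _); ring.
  by apply: kern_reg_integrable; [lra|itv_notin..].
have i4 : mu.-integrable `[1, b] (EFin \o kern_reg e 1 b (- 1) (- a)).
  by apply: kern_reg_integrable; [lra|itv_notin..].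
have nba : - b <= - a by lra.
have nb1 : - 1 <= b by lra.
have nb2 : - b <= 1 by lra.
have /andP[l2 u2] := Rintegral_inner_bounds nba nb1 bt i2 (piece2_integrable e a1 (ltW ab) bt).
have /andP[l4 u4] := Rintegral_inner_bounds nb2 (lexx b) bt i4 (piece4_integrable e a1 (ltW ab) bt).
by rewrite /inner_limit !mulrDl !lerD.
Qed.

(** Reflection carries J_1 to [a, t], which contains [b, t]. There the squared integrands compare
    like (z - b) / (z + a) and (z - a) / (z + b), that is, like z^2 - b^2 and z^2 - a^2. *)
Lemma piece5_le_piece1 t : 1 < a -> a < b -> b < t ->
  piece a b b t 5 <= piece a b (- a) t 1.
Proof.
move=> a1 ab bt; rewrite (piece1_oppr _ a1 (ltW ab) bt) piece5E opprK.
have i1 : mu.-integrable `[a, t] (EFin \o kern a a t 1 (- 1) (- b) (- t)).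
  by apply: kern_integrable; [lra|itv_notin..].
apply: (@le_trans _ _ (\int[mu]_(z in `[b, t]) kern a a t 1 (- 1) (- b) (- t) z)); last first.
  by apply: ge0_subset_Rintegral => //; [exact: ltW|move=> z _; exact: kern_ge0].
apply: le_Rintegral_itv.
- by apply: kern_integrable; [lra|itv_notin..].
- by apply: integrableS i1 => //; apply: subset_itvr; rewrite bnd_simp ltW.
move=> z; rewrite in_itv/= => /andP[z1 z2].
apply: le_div_sqrt => //; [norm_prod_gt0|norm_prod_gt0|].
unfold_norms.
set C := (z - a) * (z - b) * ((t - z) * (z - 1) * ((z + 1) * (z + t))).
have C0 : 0 <= C by rewrite /C !mulr_ge0//; lra.
rewrite (_ : (z - b) ^+ 2 * _ = C * (z ^+ 2 - b ^+ 2)); last by rewrite /C; ring.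
rewrite (_ : (z - a) ^+ 2 * _ = C * (z ^+ 2 - a ^+ 2)); last by rewrite /C; ring.
by rewrite ler_wpM2l//; nra.
Qed.

(** On [b, t] the comparison is again z^2 - b^2 <= z^2 - a^2. The reflected I_1 also covers [a, b],
    which gives the error term: there z + b and b - z are at most 2 b, while t - z and t + z are at
    least t - b. *)
Lemma piece1_le_piece5 t (M : R) : 1 < a -> a < b -> b < t ->
  0 <= M -> 1 <= M ^+ 2 * (a - 1) ->
  piece a b b t 1 <= piece a b (- a) t 5 + 6 * (2 * b * M) / (t - b).
Proof.
move=> a1 ab bt M0 hM; rewrite (piece1_oppr _ a1 (ltW ab) bt) piece5E.
set f := kern (- b) a t 1 (- 1) (- b) (- t).
have i1 : mu.-integrable `[a, t] (EFin \o f).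
  by apply: kern_integrable; [lra|itv_notin..].
have iab : mu.-integrable `[a, b] (EFin \o f).
  by apply: integrableS i1 => //; apply: subset_itvl; rewrite bnd_simp ltW.
have ibt : mu.-integrable `[b, t] (EFin \o f).
  by apply: integrableS i1 => //; apply: subset_itvr; rewrite bnd_simp ltW.
have -> : \int[mu]_(z in `[a, t]) f z =
    \int[mu]_(z in `[b, t]) f z + \int[mu]_(z in `[a, b]) f z.
  apply/eqP; rewrite -subr_eq; apply/eqP.
  rewrite (Rintegral_itvB i1) ?bnd_simp ?ltW//.
  rewrite Rintegral_itv_obnd_cbnd//.
  by apply: integrableS ibt => //; exact: subset_itv_oc_cc.
apply: lerD.
  apply: le_Rintegral_itv => //.
    by apply: kern_integrable; [lra|itv_notin..].
  move=> z; rewrite in_itv/= => /andP[z1 z2].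
  apply: le_div_sqrt => //; [norm_prod_gt0|norm_prod_gt0|].
  unfold_norms.
  set C := (z + a) * (z + b) * ((t - z) * (z - 1) * ((z + 1) * (z + t))).
  have C0 : 0 <= C by rewrite /C !mulr_ge0//; lra.
  rewrite (_ : (z - - b) ^+ 2 * _ = C * (z ^+ 2 - b ^+ 2)); last by rewrite /C; ring.
  rewrite (_ : (z - - a) ^+ 2 * _ = C * (z ^+ 2 - a ^+ 2)); last by rewrite /C; ring.
  by rewrite ler_wpM2l//; nra.
rewrite -mulrA; apply: Rintegral_le_arcsine => //.
  by rewrite divr_ge0// ?mulr_ge0//; lra.
move=> z; rewrite in_itv/= => /andP[z1 z2].
apply: le_div_sqrt; [by rewrite divr_ge0// ?mulr_ge0//; lra|norm_prod_gt0|norm_prod_gt0|].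
unfold_norms.
have tb : 0 < t - b by lra.
rewrite expr_div_n [leRHS]mulrAC ler_pdivlMr ?exprn_gt0//.
set C := (z - a) * (z + b).
have C0 : 0 <= C by rewrite /C mulr_ge0//; lra.
rewrite (_ : _ * (t - b) ^+ 2 = C * ((z + b) * (b - z) * ((t - b) * (t - b)))); last by rewrite /C; ring.
rewrite (_ : _ ^+ 2 * _ = C * ((2 * b) * (2 * b) * (M ^+ 2 * ((z - 1) * (z + 1)) * ((t - z) * (t + z))))); last by rewrite /C; ring.
apply: ler_wpM2l => //; rewrite [leRHS]mulrA.
have h1 : 1 <= M ^+ 2 * ((z - 1) * (z + 1)).
  rewrite (le_trans hM)// ler_wpM2l ?sqr_ge0//; nra.
apply: (@le_trans _ _ ((2 * b) * (2 * b) * 1 * ((t - z) * (t + z)))).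
  by rewrite mulr1; lra4.
apply: ler_wpM2r; first by rewrite mulr_ge0//; lra.
by apply: ler_wpM2l => //; rewrite mulr_ge0//; lra.
Qed.

(** From z - b <= z + a, t^2 - z^2 <= t^2 and z^2 - 1 <= z^2, the integrand is at least 1 / (z
    t). *)
Lemma piece5_ge t : 1 < a -> a < b -> b < t ->
  (ln t - ln b) / t <= piece a b (- a) t 5.
Proof.
move=> a1 ab bt; rewrite piece5E.
have b0 : 0 < b by lra.
have t0 : 0 < t by lra.
have [iv <-] := Rintegral_inv b0 bt.
rewrite -RintegralZr//.
apply: le_Rintegral_itv.
- exact: (integrableZr _ _ iv).
- by apply: kern_integrable; [lra|itv_notin..].
move=> z; rewrite in_itv/= => /andP[z1 z2].
have z0 : 0 < z by lra.
apply: kern_ge; first by rewrite mulr_ge0 ?invr_ge0 ?ltW.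
  norm_prod_gt0.
unfold_norms.
rewrite -invfM exprVn mulrC ler_pdivrMr ?exprn_gt0 ?mulr_gt0//.
rewrite (_ : _ * _ * _ = (z + a) * (z - b) * ((t - z) * (t + z) * ((z + 1) * (z - 1)))); last by ring.
rewrite (_ : _ ^+ 2 * _ = (z + a) * (z + a) * (t * t * (z * z))); last by ring.
apply: ler_pM; [by rewrite mulr_ge0//; lra|by rewrite !mulr_ge0//; lra| | ].
  by rewrite ler_wpM2l//; lra.
by apply: ler_pM; [rewrite mulr_ge0//; lra|rewrite mulr_ge0//; lra|nra|nra].
Qed.

Lemma large_t_sign : 1 < a -> a < b ->
  exists t, [/\ b + 1 <= t &
    (piece a b b t 1 + piece a b b t 5) * (piece a b (- a) t 2 + piece a b (- a) t 4) <
    (piece a b (- a) t 1 + piece a b (- a) t 5) * (piece a b b t 2 + piece a b b t 4)].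
Proof.
move=> a1 ab.
have [M M0 hM] := exists_sqr_ge (ltac:(lra) : 0 < a - 1).
set AI := inner_limit a b b; set AJ := inner_limit a b (- a).
have AJ0 : 0 <= AJ.
  by rewrite addr_ge0// Rintegral_ge0// => z _; exact: kern_reg_ge0.
have d0 : 0 < AI - AJ by rewrite subr_gt0; exact: inner_limit_lt.
have AI0 : 0 <= AI by lra.
set d := AI - AJ in d0.
pose D := 6 * (2 * b * M).
have D0 : 0 <= D by rewrite /D !mulr_ge0//; lra.
(* With t = b exp T, the last summand gives 2 b AI <= t d, hence AI (t - b) - AJ t >= d t / 2. The
   middle one makes the main term, at least T d t / 4, exceed the error D AJ t. The summand 1
   ensures t >= 2 b and t >= b + 1. *)
pose T := 1 + 4 * (D * AJ) / d + 2 * AI / d.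
have T1 : 0 <= 4 * (D * AJ) / d.
  by apply: divr_ge0; [rewrite mulr_ge0// mulr_ge0|exact: ltW].
have T2 : 0 <= 2 * AI / d by apply: divr_ge0; [exact: mulr_ge0|exact: ltW].
have Td1 : 4 * (D * AJ) < T * d.
  rewrite -ltr_pdivrMr// /T; move: (_ / d) (_ / d) T1 T2 => x y; lra.
have Td2 : 2 * AI <= T * d.
  rewrite -ler_pdivrMr// /T; move: (_ / d) (_ / d) T1 T2 => x y; lra.
have T3 : 1 <= T by rewrite /T; move: (_ / d) (_ / d) T1 T2 => x y; lra.
have eT : 1 + T <= expR T := expR_ge1Dx T.
exists (b * expR T); set t := b * expR T.
have tT : b * (1 + T) <= t by rewrite ler_wpM2l//; lra.
have tb : b + 1 <= t by nra.
split => //.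
have bt : b < t by lra.
have t2b : 2 * b <= t by nra.
have lnt : ln t - ln b = T.
  by rewrite /t lnM ?posrE ?expR_gt0//; [rewrite expRK addrC addKr|lra].
clearbody t.
have := piece5_ge a1 ab bt; rewrite lnt => hJ.
have hI5 := piece5_le_piece1 a1 ab bt.
have hI1 := piece1_le_piece5 a1 ab bt M0 hM; rewrite -/D in hI1.
have /andP[hIi _] := inner_bounds b a1 ab bt; have /andP[_ hJi] := inner_bounds (- a) a1 ab bt.
rewrite -/AI in hIi; rewrite -/AJ in hJi.
have J1 := piece_ge0 a b (- a) t 1.
have I1 := piece_ge0 a b b t 1; have I5 := piece_ge0 a b b t 5.
have Ji0 : 0 <= piece a b (- a) t 2 + piece a b (- a) t 4 by rewrite addr_ge0 ?piece_ge0.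
set Ii := piece a b b t 2 + _ in hIi *; set Ji := piece a b (- a) t 2 + _ in hJi Ji0 *.
set Io := piece a b b t 1 + _; set Jo := piece a b (- a) t 1 + _.
have s0 : 0 < t - b by lra.
have t0 : 0 < t by lra.
have Io0 : 0 <= Io by rewrite addr_ge0.
have hJo : T <= Jo * t by rewrite -ler_pdivrMr//; apply: (le_trans hJ); rewrite lerDr.
have hIo : Io * (t - b) <= Jo * (t - b) + D.
  rewrite -ler_pdivlMr// mulrDl mulfK ?lt0r_neq0// /Io /Jo addrC -addrA lerD//.
rewrite ler_pdivrMr// in hIi; rewrite ler_pdivlMr// in hJi.
have Jo0 : 0 < Jo by rewrite -(pmulr_lgt0 _ t0) (lt_le_trans _ hJo)//; lra.
(* This factor clears the denominators of the bounds on [Io], [Ji] and [Ii]; the claim becomes D AJ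
   t < Jo (t - b) (AI (t - b) - AJ t). *)
rewrite -(@ltr_pM2r _ ((t - b) ^+ 2 * t)) ?mulr_gt0 ?exprn_gt0//.
apply: (@le_lt_trans _ _ ((Jo * (t - b) + D) * AJ * t)).
  rewrite (_ : _ * _ * (_ * t) = Io * (t - b) * (Ji * (t - b)) * t); last by ring.
  apply: ler_wpM2r; first exact: ltW.
  by apply: ler_pM => //; rewrite mulr_ge0// ltW.
apply: (@lt_le_trans _ _ (Jo * AI * (t - b) ^+ 2)); last first.
  rewrite (_ : Jo * Ii * _ = Jo * (Ii * t) * (t - b) ^+ 2); last by ring.
  by rewrite ler_wpM2r ?sqr_ge0// ler_wpM2l// ltW.
rewrite -subr_gt0 (_ : _ - _ = Jo * (t - b) * (AI * (t - b) - AJ * t) - D * AJ * t); last by ring.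
rewrite subr_gt0.
have h1 : d * t / 2 <= AI * (t - b) - AJ * t.
  have : b * (2 * AI) <= b * (T * d) by rewrite ler_wpM2l//; lra.
  have : b * T * d <= t * d by rewrite ler_wpM2r ?(ltW d0)//; nra.
  by rewrite /d; lra.
apply: (@lt_le_trans _ _ (Jo * (t - b) * (d * t / 2))); last first.
  by rewrite ler_wpM2l// mulr_ge0// ltW.
rewrite (_ : Jo * (t - b) * (d * t / 2) = (Jo * t) * (d * (t - b)) / 2); last by field.
apply: (@lt_le_trans _ _ (T * (d * (t - b)) / 2)); last first.
  by rewrite ler_wpM2r// ler_wpM2r// mulr_ge0// ltW.
apply: (@lt_le_trans _ _ (T * d * (t / 2) / 2)); last first.
  by rewrite ler_wpM2r// [leRHS]mulrA ler_wpM2l//; [rewrite mulr_ge0 ?(ltW d0)//|]; lra.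
rewrite (_ : T * d * (t / 2) / 2 = T * d / 4 * t); last by field.
by rewrite ltr_pM2r// ltr_pdivlMr// mulrC.
Qed.

End large_t.

(** * The period condition *)

Lemma Q_diag (R : realType) (a t : R) : 1 < a -> a < t -> Q a a t = 0.
Proof.
move=> a1 at_; rewrite /Q !I_E !J_E !piece_swap15// !piece_swap24// opprK.
rewrite [X in X / _ - _]addrC [X in _ / X - _]addrC.
by rewrite subrr.
Qed.

Lemma Q_root (R : realType) (a b : R) : 1 < a -> a < b ->
  exists t, b < t /\ Q a b t = 0.
Proof.
move=> a1 ab.
have [t1 [bt1 t1b n1]] := near_b_sign a1 ab.
have [t2 [t2b n2]] := large_t_sign a1 ab.
pose N t := (piece a b b t 1 + piece a b b t 5) *
    (piece a b (- a) t 2 + piece a b (- a) t 4) -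
  (piece a b (- a) t 1 + piece a b (- a) t 5) *
    (piece a b b t 2 + piece a b b t 4).
have N1 : 0 < N t1 by rewrite subr_gt0.
have N2 : N t2 < 0 by rewrite subr_lt0.
have t12 : t1 <= t2 := le_trans t1b t2b.
(* Continuity is available on open intervals whose left end exceeds b; the midpoint leaves room to
   the left of [t1]. *)
have bm : b < (b + t1) / 2 by move: bt1; clear; lra.
have cN : {within `[t1, t2], continuous N}.
  apply: continuous_within_itv => t; rewrite in_itv/= => /andP[l1 l2].
  have tI : t \in `](b + t1) / 2, (t2 + 1)[ by rewrite in_itv/=; move: bt1 l1 l2; clear => *; apply/andP; split; lra.
  have cp e k : k \in [:: 1; 2; 4; 5]%N -> {for t, continuous (piece a b e ^~ k)}.
    by move=> kI; exact: (@piece_continuous R a b e k _ _ a1 (ltW ab) bm kI t tI).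
  by rewrite /N; continuity (t : R); exact: cp.
have [|t tI Nt0] := @IVT R N t1 t2 0 t12 cN.
  by rewrite ge_min le_max (ltW N1) (ltW N2) orbT.
have bt : b < t by move: tI; rewrite in_itv/= => /andP[? _]; exact: lt_le_trans bt1 _.
exists t; split => //.
have t0 : 0 < t by move: a1 ab bt; clear; lra.
have /andP[hI _] := inner_bounds b a1 ab bt.
have Ii0 : 0 < piece a b b t 2 + piece a b b t 4.
  apply: lt_le_trans hI; rewrite divr_gt0//.
  apply: (le_lt_trans _ (inner_limit_lt a1 ab)).
  by rewrite addr_ge0// Rintegral_ge0// => z _; exact: kern_reg_ge0.
have Jo0 : 0 < piece a b (- a) t 1 + piece a b (- a) t 5.
  apply: ltr_wpDl; first exact: piece_ge0.
  apply: lt_le_trans (piece5_ge a1 ab bt).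
  by rewrite divr_gt0// subr_gt0 ltr_ln ?posrE//; move: a1 ab; clear; lra.
move/eqP: Nt0; rewrite subr_eq0 => /eqP Nt.
(* If J_2 + J_4 vanished, N t = 0 would make (J_1 + J_5) (I_2 + I_4) vanish, although both factors
   are positive. *)
have Ji0 : piece a b (- a) t 2 + piece a b (- a) t 4 != 0.
  apply: contraTneq (mulr_gt0 Jo0 Ii0) => Ji0.
  by rewrite -Nt Ji0 mulr0 ltxx.
rewrite /Q !I_E !J_E; apply/eqP; rewrite subr_eq0.
rewrite eqr_div//; last exact: lt0r_neq0.
by apply/eqP.
Qed.

Theorem theorem4p1 (R : realType) (a b : R) (ha : 1 < a) (hab : a <= b) :
  (a = b -> forall t : R, b < t -> Q a b t = 0) /\
  (a < b -> exists t : R, b < t /\ Q a b t = 0).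
Proof.
split; last exact: Q_root.
by move=> <- t; exact: Q_diag.
Qed.
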